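(* Let $n\ge1$ and let $\mathbf{X}$ be a nonempty strict $n$-category. Then $$MH_k^{n+1}(\Gamma\mathbf{X})\cong\begin{cases}\mathbb{Z}&k=0\\ MH_{k-1}^n(\mathbf{X})&k\ge2\end{cases}$$ while $$MH_1^{n+1}(\Gamma\mathbf{X})\oplus\mathbb{Z}\cong MH_0^n(\mathbf{X}).$$
   Context: Strict $n$-categories are small: a strict $1$-category is a small category, and for $n>1$ a strict $n$-category is a small category enriched in the category $(n-1)\mathbf{Cat}$ of strict $(n-1)$-categories with cartesian product. Suspension: given a strict $n$-category $\mathbf{X}$, the suspension of $\mathbf{X}$ is a strict $(n+1)$-category $\Gamma\mathbf{X}$ with two objects, $A$ and $B$; the $n$-category $\Gamma\mathbf{X}(A,B)$ is equivalent to $\mathbf{X}$, while $\Gamma\mathbf{X}(B,A)$ is empty and the other two hom objects, $\Gamma\mathbf{X}(A,A)$ and $\Gamma\mathbf{X}(B,B)$, are given by the terminal $n$-category. Magnitude nerve: let $(\mathcal{V},\otimes,I)$ be a symmetric monoidal category whose unit $I$ is terminal, and let $\Sigma:\mathcal{V}\to\mathbb{A}$ be a strong symmetric monoidal functor to a symmetric monoidal closed abelian category with unit $\mathbb{I}$. For a $\mathcal{V}$-category $\mathbf{X}$, $MB^\Sigma(\mathbf{X})$ is the simplicial object of $\mathbb{A}$ with $MB^\Sigma_m(\mathbf{X})=\bigoplus_{x_0,\dots,x_m\in\mathbf{X}}\Sigma\mathbf{X}(x_0,x_1)\otimes\cdots\otimes\Sigma\mathbf{X}(x_{m-1},x_m)$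 (and $MB^\Sigma_0(\mathbf{X})=\bigoplus_{x\in\mathbf{X}}\mathbb{I}$); inner faces are induced by composition, the outer faces by the terminal maps $\mathbf{X}(x_0,x_1)\to I$ and $\mathbf{X}(x_{m-1},x_m)\to I$, and degeneracies by inserting identities. The functor $MB^\Sigma$ is strong symmetric monoidal for the pointwise tensor product on simplicial objects of $\mathbb{A}$, and so can itself be used as a coefficient functor. Let $\Sigma:\mathbf{Set}\to\mathbf{Ab}$ be the free abelian group functor. Set $MB^1=MB^\Sigma:\mathbf{Cat}\to[\Delta^{\mathrm{op}},\mathbf{Ab}]$ and, for each $n>1$, $MB^n=\mathrm{diag}\left(MB^{MB^{n-1}}(-)\right):n\mathbf{Cat}\to[\Delta^{\mathrm{op}},\mathbf{Ab}]$, where $MB^{MB^{n-1}}$ is the magnitude nerve with coefficient functor $MB^{n-1}:(n-1)\mathbf{Cat}\to[\Delta^{\mathrm{op}},\mathbf{Ab}]$ (its values are bisimplicial abelian groups) and $\mathrm{diag}$ takes the diagonal simplicial object. The magnitude homology $MH^n_\bullet(\mathbf{X})$ of a strict $n$-category $\mathbf{X}$ is the homology of the unnormalized chain complex (differential the alternating sum of the face maps) of $MB^n(\mathbf{X})$. *)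

(* Defs.v *)
From HB Require Import structures.
From mathcomp Require Import all_boot all_order all_algebra.
From mathcomp Require Import boolp.

Set Implicit Arguments.
Unset Strict Implicit.
Unset Printing Implicit Defensive.

Import GRing.Theory.
Local Open Scope ring_scope.

Section AdditiveMaps.

Definition additive_of (A B : zmodType) (f : A -> B)
  (fD : {morph f : x y / x + y}) : {additive A -> B}.
Proof.
pose fB : zmod_morphism f :=
  fun x y => etrans (esym (addrK (f y) (f (x - y))))
                    (congr1 (fun z => z - f y)
                       (etrans (esym (fD _ _)) (congr1 f (subrK _ _)))).
pose m := GRing.isZmodMorphism.Build A B f fB.
exact (HB.pack_for ({additive A -> B}) f m).
Defined.

Definition acomp (A B C : zmodType) (g : {additive B -> C})
  (f : {additive A -> B}) : {additive A -> C} := g \o f.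

Definition aid (A : zmodType) : {additive A -> A} := idfun.

Definition aadd (A B : zmodType) (f g : {additive A -> B}) : {additive A -> B} :=
  f \+ g.

Lemma aaddE (A B : zmodType) (f g : {additive A -> B}) x :
  aadd f g x = f x + g x.
Proof. by []. Qed.

Lemma acompE (A B C : zmodType) (g : {additive B -> C})
  (f : {additive A -> B}) x : acomp g f x = g (f x).
Proof. by []. Qed.

Definition zmod_iso (A B : zmodType) : Prop :=
  exists f : {additive A -> B}, bijective f.

End AdditiveMaps.

Inductive word (G : Type) : Type :=
| wgen of G
| wzero
| wopp of word G
| wadd of word G & word G.
Arguments wzero {G}.

HB.instance Definition _ (G : Type) := gen_eqMixin (word G).
HB.instance Definition _ (G : Type) := gen_choiceMixin (word G).

(** The congruence generated by [R] and the axioms of abelian groups: [word G]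
    modulo [weq R] is the abelian group with generators [G] and relations [R].
    The generators come from arbitrary types, with no choice structure. *)
Inductive weq (G : Type) (R : word G -> word G -> Prop) :
  word G -> word G -> Prop :=
| weq_rel s t : R s t -> weq R s t
| weq_refl s : weq R s s
| weq_sym s t : weq R s t -> weq R t s
| weq_trans s t u : weq R s t -> weq R t u -> weq R s u
| weq_opp s t : weq R s t -> weq R (wopp s) (wopp t)
| weq_add s s' t t' : weq R s s' -> weq R t t' -> weq R (wadd s t) (wadd s' t')
| weq_addA s t u : weq R (wadd s (wadd t u)) (wadd (wadd s t) u)
| weq_addC s t : weq R (wadd s t) (wadd t s)
| weq_add0 s : weq R (wadd wzero s) s
| weq_addN s : weq R (wadd (wopp s) s) wzero.

Section Presentation.
Variables (G : Type) (R : word G -> word G -> Prop).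
Local Open Scope quotient_scope.

Definition weqb : rel (word G) := fun s t => `[< weq R s t >].

Lemma weqb_equiv : equiv_class_of weqb.
Proof.
split=> [s|s t|t s u].
- by apply/asboolP; apply: weq_refl.
- by apply/asboolP/asboolP; apply: weq_sym.
- by move=> /asboolP h1 /asboolP h2; apply/asboolP; apply: weq_trans h1 h2.
Qed.

Canonical weqb_rel := EquivRelPack weqb_equiv.
Canonical weqb_enc := defaultEncModRel weqb.

Definition presented := {eq_quot weqb}.

HB.instance Definition _ := EqQuotient.on presented.
HB.instance Definition _ := Choice.on presented.

Lemma pi_weq s t : weq R s t -> \pi_presented s = \pi_presented t.
Proof. by move=> h; apply/eqmodP/asboolP. Qed.

Lemma weq_pi s t : \pi_presented s = \pi_presented t -> weq R s t.
Proof. by move=> /eqmodP/asboolP. Qed.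

Definition presented_add (x y : presented) : presented :=
  \pi_presented (wadd (repr x) (repr y)).
Definition presented_opp (x : presented) : presented := \pi_presented (wopp (repr x)).

Lemma pi_wadd s t :
  presented_add (\pi_presented s) (\pi_presented t) = \pi_presented (wadd s t).
Proof. by apply: pi_weq; apply: weq_add; apply: weq_pi; rewrite reprK. Qed.

Lemma pi_wopp s : presented_opp (\pi_presented s) = \pi_presented (wopp s).
Proof. by apply: pi_weq; apply: weq_opp; apply: weq_pi; rewrite reprK. Qed.

Fact presented_addA : associative presented_add.
Proof.
elim/quotW=> s; elim/quotW=> t; elim/quotW=> u.
rewrite (pi_wadd t u) (pi_wadd s) (pi_wadd s t) (pi_wadd _ u).
by apply: pi_weq; apply: weq_addA.
Qed.
Fact presented_addC : commutative presented_add.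
Proof. by move=> x y; apply: pi_weq; apply: weq_addC. Qed.
Fact presented_add0 : left_id (\pi_presented wzero) presented_add.
Proof.
by elim/quotW=> s; rewrite pi_wadd; apply: pi_weq; apply: weq_add0.
Qed.
Fact presented_addN :
  left_inverse (\pi_presented wzero) presented_opp presented_add.
Proof.
by elim/quotW=> s; rewrite pi_wopp pi_wadd; apply: pi_weq; apply: weq_addN.
Qed.

HB.instance Definition _ := GRing.isZmodule.Build presented
  presented_addA presented_addC presented_add0 presented_addN.

Definition pgen (g : G) : presented := \pi_presented (wgen g).

Variables (A : zmodType) (h : G -> A).

Fixpoint weval (s : word G) : A :=
  match s with
  | wgen g => h g
  | wzero => 0
  | wopp s => - weval s
  | wadd s t => weval s + weval t
  end.

Hypothesis hR : forall s t, R s t -> weval s = weval t.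

Lemma weval_weq s t : weq R s t -> weval s = weval t.
Proof.
elim=> {s t} [s t /hR //|//|s t _ -> //|s t u _ -> _ -> //|s t _ /= -> //
  |s s' t t' _ /= -> _ -> //|s t u /=|s t /=|s /=|s /=].
- exact: addrA.
- exact: addrC.
- exact: add0r.
- exact: addNr.
Qed.

Definition presented_fun (x : presented) : A := weval (repr x).

Lemma presented_funE s : presented_fun (\pi_presented s) = weval s.
Proof. by apply: weval_weq; apply: weq_pi; rewrite reprK. Qed.

Fact presented_fun_add : {morph presented_fun : x y / x + y}.
Proof.
elim/quotW=> s; elim/quotW=> t.
by rewrite [_ + _]pi_wadd !presented_funE.
Qed.

Definition presented_lift : {additive presented -> A} :=
  additive_of presented_fun_add.

Lemma presented_liftE g : presented_lift (pgen g) = h g.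
Proof. exact: presented_funE. Qed.

End Presentation.

Lemma presented_ext (G : Type) (R : word G -> word G -> Prop) (A : zmodType)
  (f g : {additive presented R -> A}) :
  (forall x, f (pgen R x) = g (pgen R x)) -> f =1 g.
Proof.
move=> fg; elim/quotW; elim=> [x||s IH|s IHs t IHt].
- exact: fg.
- by rewrite -[LHS]/(f 0) -[RHS]/(g 0) !raddf0.
- by rewrite -pi_wopp -[LHS]/(f (- _)) -[RHS]/(g (- _)) !raddfN IH.
- by rewrite -pi_wadd -[LHS]/(f (_ + _)) -[RHS]/(g (_ + _)) !raddfD IHs IHt.
Qed.

Section FreeAbelianGroup.

Inductive free_rel (S : Type) : word S -> word S -> Prop := .

Definition free_ab (S : Type) : zmodType := presented (@free_rel S).

Definition free_gen (S : Type) (s : S) : free_ab S := pgen (@free_rel S) s.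

Definition free_lift (S : Type) (A : zmodType) (h : S -> A) :
  {additive free_ab S -> A} :=
  @presented_lift S (@free_rel S) A h
    (fun s t r => match r with end).

End FreeAbelianGroup.

Section Tensor.

Inductive tensor_rel (A B : zmodType) :
  word (A * B)%type -> word (A * B)%type -> Prop :=
| tensor_addl a a' b :
    tensor_rel (wgen (a + a', b)) (wadd (wgen (a, b)) (wgen (a', b)))
| tensor_addr a b b' :
    tensor_rel (wgen (a, b + b')) (wadd (wgen (a, b)) (wgen (a, b'))).

Definition tensor (A B : zmodType) : zmodType := presented (@tensor_rel A B).

Definition tens (A B : zmodType) (a : A) (b : B) : tensor A B :=
  pgen (@tensor_rel A B) (a, b).

Fact tensDl (A B : zmodType) (b : B) : {morph (@tens A B)^~ b : a a' / a + a'}.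
Proof. by move=> a a'; rewrite [RHS]pi_wadd; apply/pi_weq/weq_rel/tensor_addl. Qed.

Fact tensDr (A B : zmodType) (a : A) : {morph @tens A B a : b b' / b + b'}.
Proof. by move=> b b'; rewrite [RHS]pi_wadd; apply/pi_weq/weq_rel/tensor_addr. Qed.

Lemma tensor_lift_subproof (A B C : zmodType) (h : A -> B -> C)
  (hl : forall b, {morph h^~ b : x y / x + y})
  (hr : forall a, {morph h a : x y / x + y}) s t :
  tensor_rel s t ->
  weval (fun p => h p.1 p.2) s = weval (fun p => h p.1 p.2) t.
Proof. by case=> [a a' b|a b b'] /=; [apply: hl|apply: hr]. Qed.

Definition tensor_lift (A B C : zmodType) (h : A -> B -> C)
  (hl : forall b, {morph h^~ b : x y / x + y})
  (hr : forall a, {morph h a : x y / x + y}) : {additive tensor A B -> C} :=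
  presented_lift (tensor_lift_subproof hl hr).

Lemma tensor_liftE (A B C : zmodType) (h : A -> B -> C)
  (hl : forall b, {morph h^~ b : x y / x + y})
  (hr : forall a, {morph h a : x y / x + y}) a b :
  tensor_lift hl hr (tens a b) = h a b.
Proof. exact: presented_liftE. Qed.

Lemma tensor_ext (A B C : zmodType) (f g : {additive tensor A B -> C}) :
  (forall a b, f (tens a b) = g (tens a b)) -> forall t, f t = g t.
Proof. by move=> fg; apply: presented_ext => -[a b]; apply: fg. Qed.

Definition tensor_map (A A' B B' : zmodType) (f : {additive A -> A'})
  (g : {additive B -> B'}) : {additive tensor A B -> tensor A' B'}.
Proof.
apply: (@tensor_lift A B (tensor A' B') (fun a b => tens (f a) (g b))).
- by move=> b x y /=; rewrite raddfD tensDl.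
- by move=> a x y /=; rewrite raddfD tensDr.
Defined.

Lemma tensor_mapE (A A' B B' : zmodType) (f : {additive A -> A'})
  (g : {additive B -> B'}) a b :
  tensor_map f g (tens a b) = tens (f a) (g b).
Proof. exact: tensor_liftE. Qed.

(** The associator [A (x) (B (x) C) -> (A (x) B) (x) C] *)
Definition tensor_assoc_slice (A B C : zmodType) (a : A) :
  {additive tensor B C -> tensor (tensor A B) C}.
Proof.
apply: (@tensor_lift B C _ (fun b c => tens (tens a b) c)).
- by move=> c x y /=; rewrite tensDr tensDl.
- by move=> b x y /=; rewrite tensDr.
Defined.

Lemma tensor_assoc_sliceE (A B C : zmodType) (a : A) (b : B) (c : C) :
  tensor_assoc_slice B C a (tens b c) = tens (tens a b) c.
Proof. exact: tensor_liftE. Qed.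

Definition tensor_assoc (A B C : zmodType) :
  {additive tensor A (tensor B C) -> tensor (tensor A B) C}.
Proof.
apply: (@tensor_lift A (tensor B C) _ (fun a t => tensor_assoc_slice B C a t)).
- move=> t a a' /=; move: t.
  apply: (tensor_ext (f := tensor_assoc_slice B C (a + a'))
    (g := aadd (tensor_assoc_slice B C a) (tensor_assoc_slice B C a'))).
  by move=> b c; rewrite aaddE !tensor_assoc_sliceE !tensDl.
- by move=> a x y; rewrite raddfD.
Defined.

Lemma tensor_assocE (A B C : zmodType) (a : A) (b : B) (c : C) :
  tensor_assoc A B C (tens a (tens b c)) = tens (tens a b) c.
Proof. by rewrite [LHS]tensor_liftE tensor_assoc_sliceE. Qed.

(** The interchange [(A (x) C) (x) (B (x) D) -> (A (x) B) (x) (C (x) D)],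
    composed of associators and one symmetry. *)
Definition tensor_swap_slice (A B C D : zmodType) (a : A) (c : C) :
  {additive tensor B D -> tensor (tensor A B) (tensor C D)}.
Proof.
apply: (@tensor_lift B D _ (fun b d => tens (tens a b) (tens c d))).
- by move=> d x y /=; rewrite tensDr tensDl.
- by move=> b x y /=; rewrite !tensDr.
Defined.

Lemma tensor_swap_sliceE (A B C D : zmodType) (a : A) (c : C) (b : B) (d : D) :
  tensor_swap_slice B D a c (tens b d) = tens (tens a b) (tens c d).
Proof. exact: tensor_liftE. Qed.

Definition tensor_swap_half (A B C D : zmodType) (v : tensor B D) :
  {additive tensor A C -> tensor (tensor A B) (tensor C D)}.
Proof.
apply: (@tensor_lift A C _ (fun a c => tensor_swap_slice B D a c v)).
- move=> c a a' /=; move: v.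
  apply: (tensor_ext (f := tensor_swap_slice B D (a + a') c)
    (g := aadd (tensor_swap_slice B D a c) (tensor_swap_slice B D a' c))).
  by move=> b d; rewrite aaddE !tensor_swap_sliceE !tensDl.
- move=> a c c' /=; move: v.
  apply: (tensor_ext (f := tensor_swap_slice B D a (c + c'))
    (g := aadd (tensor_swap_slice B D a c) (tensor_swap_slice B D a c'))).
  by move=> b d; rewrite aaddE !tensor_swap_sliceE tensDl tensDr.
Defined.

Lemma tensor_swap_halfE (A B C D : zmodType) (v : tensor B D) (a : A) (c : C) :
  tensor_swap_half A C v (tens a c) = tensor_swap_slice B D a c v.
Proof. exact: tensor_liftE. Qed.

Definition tensor_swap (A B C D : zmodType) :
  {additive tensor (tensor A C) (tensor B D)
            -> tensor (tensor A B) (tensor C D)}.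
Proof.
apply: (@tensor_lift (tensor A C) (tensor B D) _
          (fun u v => tensor_swap_half A C v u)).
- by move=> v x y; apply: raddfD.
- move=> u v v' /=; move: u.
  apply: (tensor_ext (f := tensor_swap_half A C (v + v'))
    (g := aadd (tensor_swap_half A C v) (tensor_swap_half A C v'))).
  by move=> a c; rewrite aaddE !tensor_swap_halfE; apply: raddfD.
Defined.

Lemma tensor_swapE (A B C D : zmodType) (a : A) (b : B) (c : C) (d : D) :
  tensor_swap A B C D (tens (tens a c) (tens b d)) =
  tens (tens a b) (tens c d).
Proof. by rewrite [LHS]tensor_liftE tensor_swap_halfE tensor_swap_sliceE. Qed.

Definition int_scale (A : zmodType) (a : A) : {additive int -> A} :=
  additive_of (fun m n => mulrzDr a m n).

(** [A (x) C -> Z (x) C ~ C] for a given [e : A -> Z] *)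
Definition tensor_unitl (A C : zmodType) (e : {additive A -> int}) :
  {additive tensor A C -> C}.
Proof.
apply: (@tensor_lift A C C (fun a c => c *~ e a)).
- by move=> c x y /=; rewrite raddfD mulrzDr.
- by move=> a x y /=; rewrite mulrzDl.
Defined.

Lemma tensor_unitlE (A C : zmodType) (e : {additive A -> int}) a (c : C) :
  tensor_unitl C e (tens a c) = c *~ e a.
Proof. exact: tensor_liftE. Qed.

Definition tens_with (A C : zmodType) (a : A) : {additive C -> tensor A C} :=
  additive_of (@tensDr A C a).

End Tensor.

Section DirectSum.

Inductive dsum_rel (I : Type) (A : I -> zmodType) :
  word {i & A i} -> word {i & A i} -> Prop :=
| dsum_add i (a b : A i) :
    dsum_rel (wgen (existT A i (a + b)))
             (wadd (wgen (existT A i a)) (wgen (existT A i b))).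

Definition dsum (I : Type) (A : I -> zmodType) : zmodType :=
  presented (@dsum_rel I A).

Fact dsum_in_add (I : Type) (A : I -> zmodType) (i : I) :
  {morph (fun a : A i => pgen (@dsum_rel I A) (existT A i a)) : a b / a + b}.
Proof. by move=> a b; rewrite [RHS]pi_wadd; apply/pi_weq/weq_rel/dsum_add. Qed.

Definition dsum_in (I : Type) (A : I -> zmodType) (i : I) :
  {additive A i -> dsum A} := additive_of (@dsum_in_add I A i).

Lemma dsum_lift_subproof (I : Type) (A : I -> zmodType) (B : zmodType)
  (h : forall i, {additive A i -> B}) s t : dsum_rel s t ->
  weval (fun p : {i & A i} => h (tag p) (tagged p)) s =
  weval (fun p : {i & A i} => h (tag p) (tagged p)) t.
Proof. by case=> i a b /=; rewrite raddfD. Qed.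

Definition dsum_lift (I : Type) (A : I -> zmodType) (B : zmodType)
  (h : forall i, {additive A i -> B}) : {additive dsum A -> B} :=
  presented_lift (dsum_lift_subproof h).

Lemma dsum_liftE (I : Type) (A : I -> zmodType) (B : zmodType)
  (h : forall i, {additive A i -> B}) i a :
  dsum_lift h (dsum_in A i a) = h i a.
Proof. exact: presented_liftE. Qed.

Lemma dsum_ext (I : Type) (A : I -> zmodType) (B : zmodType)
  (f g : {additive dsum A -> B}) :
  (forall i a, f (dsum_in A i a) = g (dsum_in A i a)) -> forall t, f t = g t.
Proof. by move=> fg; apply: presented_ext => -[i a]; apply: fg. Qed.

Definition dsum_map (I J : Type) (A : I -> zmodType) (B : J -> zmodType)
  (u : I -> J) (f : forall i, {additive A i -> B (u i)}) :
  {additive dsum A -> dsum B} :=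
  dsum_lift (fun i => acomp (dsum_in B (u i)) (f i)).

Lemma dsum_mapE (I J : Type) (A : I -> zmodType) (B : J -> zmodType)
  (u : I -> J) (f : forall i, {additive A i -> B (u i)}) i a :
  dsum_map f (dsum_in A i a) = dsum_in B (u i) (f i a).
Proof. exact: dsum_liftE. Qed.

(** [(+)_i A i (x) (+)_j B j -> (+)_k C k], using that [(x)] distributes over
    [(+)] *)
Definition dsum_tensor_slice (I J K : Type)
  (A : I -> zmodType) (B : J -> zmodType) (C : K -> zmodType) (u : I -> J -> K)
  (f : forall i j, {additive tensor (A i) (B j) -> C (u i j)})
  (i : I) (a : A i) : {additive dsum B -> dsum C} :=
  dsum_map (fun j => acomp (f i j) (tens_with (B j) a)).

Lemma dsum_tensor_sliceE (I J K : Type)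
  (A : I -> zmodType) (B : J -> zmodType) (C : K -> zmodType) (u : I -> J -> K)
  (f : forall i j, {additive tensor (A i) (B j) -> C (u i j)})
  (i : I) (a : A i) j (b : B j) :
  dsum_tensor_slice f a (dsum_in B j b) = dsum_in C (u i j) (f i j (tens a b)).
Proof. exact: dsum_liftE. Qed.

Definition dsum_tensor_half (I J K : Type)
  (A : I -> zmodType) (B : J -> zmodType) (C : K -> zmodType) (u : I -> J -> K)
  (f : forall i j, {additive tensor (A i) (B j) -> C (u i j)})
  (v : dsum B) : {additive dsum A -> dsum C}.
Proof.
apply: dsum_lift => i.
apply: (@additive_of (A i) (dsum C) (fun a => dsum_tensor_slice f a v)).
move=> a a' /=; move: v.
apply: (dsum_ext (f := dsum_tensor_slice f (a + a'))
  (g := aadd (dsum_tensor_slice f a) (dsum_tensor_slice f a'))).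
by move=> j b; rewrite aaddE !dsum_tensor_sliceE tensDl !raddfD.
Defined.

Lemma dsum_tensor_halfE (I J K : Type)
  (A : I -> zmodType) (B : J -> zmodType) (C : K -> zmodType) (u : I -> J -> K)
  (f : forall i j, {additive tensor (A i) (B j) -> C (u i j)})
  (v : dsum B) i (a : A i) :
  dsum_tensor_half f v (dsum_in A i a) = dsum_tensor_slice f a v.
Proof. exact: dsum_liftE. Qed.

Definition dsum_tensor (I J K : Type)
  (A : I -> zmodType) (B : J -> zmodType) (C : K -> zmodType) (u : I -> J -> K)
  (f : forall i j, {additive tensor (A i) (B j) -> C (u i j)}) :
  {additive tensor (dsum A) (dsum B) -> dsum C}.
Proof.
apply: (@tensor_lift (dsum A) (dsum B) _ (fun x v => dsum_tensor_half f v x)).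
- by move=> v x y; rewrite raddfD.
- move=> x v v' /=; move: x.
  apply: (dsum_ext (f := dsum_tensor_half f (v + v'))
    (g := aadd (dsum_tensor_half f v) (dsum_tensor_half f v'))).
  by move=> i a; rewrite aaddE !dsum_tensor_halfE; apply: raddfD.
Defined.

Lemma dsum_tensorE (I J K : Type)
  (A : I -> zmodType) (B : J -> zmodType) (C : K -> zmodType) (u : I -> J -> K)
  (f : forall i j, {additive tensor (A i) (B j) -> C (u i j)}) i j a b :
  dsum_tensor f (tens (dsum_in A i a) (dsum_in B j b)) =
  dsum_in C (u i j) (f i j (tens a b)).
Proof. by rewrite [LHS]tensor_liftE dsum_tensor_halfE dsum_tensor_sliceE. Qed.

End DirectSum.

Section FreeMonoidal.

Definition free_mu_half (S T : Type) (y : free_ab T) :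
  {additive free_ab S -> free_ab (S * T)} :=
  free_lift (fun s => free_lift (fun t => free_gen (s, t)) y).

Fact free_mu_addl (S T : Type) (y : free_ab T) :
  {morph (fun x => free_mu_half S y x) : x x' / x + x'}.
Proof. by move=> x x'; apply: raddfD. Qed.

Fact free_mu_addr (S T : Type) (x : free_ab S) :
  {morph (fun y : free_ab T => free_mu_half S y x) : y y' / y + y'}.
Proof.
move=> y y' /=; move: x.
apply: (presented_ext (f := free_mu_half S (y + y'))
  (g := aadd (free_mu_half S y) (free_mu_half S y'))) => s.
rewrite aaddE ![free_mu_half _ _ _]presented_liftE; exact: raddfD.
Qed.

(** [Z[S] (x) Z[T] -> Z[S x T]] *)
Definition free_mu (S T : Type) :
  {additive tensor (free_ab S) (free_ab T) -> free_ab (S * T)} :=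
  tensor_lift (@free_mu_addl S T) (@free_mu_addr S T).

Lemma free_muE (S T : Type) (s : S) (t : T) :
  free_mu S T (tens (free_gen s) (free_gen t)) = free_gen (s, t).
Proof.
by rewrite [LHS]tensor_liftE [LHS]presented_liftE [LHS]presented_liftE.
Qed.

End FreeMonoidal.

Record cartcat := CartCat {
  ob :> Type;
  hom : ob -> ob -> Type;
  idc : forall a, hom a a;
  cmp : forall a b c, hom b c -> hom a b -> hom a c;
  cmpA : forall a b c d (h : hom c d) (g : hom b c) (f : hom a b),
    cmp (cmp h g) f = cmp h (cmp g f);
  cmp1f : forall a b (f : hom a b), cmp (idc b) f = f;
  cmpf1 : forall a b (f : hom a b), cmp f (idc a) = f;
  one : ob;
  bang : forall a, hom a one;
  bangP : forall a (f : hom a one), f = bang a;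
  prd : ob -> ob -> ob;
  pr1 : forall a b, hom (prd a b) a;
  pr2 : forall a b, hom (prd a b) b;
  pair_to : forall c a b, hom c a -> hom c b -> hom c (prd a b);
  pr1_pair : forall c a b (f : hom c a) (g : hom c b),
    cmp (pr1 a b) (pair_to f g) = f;
  pr2_pair : forall c a b (f : hom c a) (g : hom c b),
    cmp (pr2 a b) (pair_to f g) = g;
  pairP : forall c a b (h : hom c (prd a b)),
    h = pair_to (cmp (pr1 a b) h) (cmp (pr2 a b) h)
}.

Arguments hom {V} _ _ : rename.
Arguments idc {V} a : rename.
Arguments cmp {V a b c} _ _ : rename.
Arguments one {V} : rename.
Arguments bang {V} a : rename.
Arguments prd {V} _ _ : rename.
Arguments pr1 {V a b} : rename.
Arguments pr2 {V a b} : rename.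
Arguments pair_to {V c a b} _ _ : rename.

Declare Scope cart_scope.
Delimit Scope cart_scope with cart.
Bind Scope cart_scope with hom.
Notation "g \oc f" := (cmp g f) (at level 50, left associativity) : cart_scope.
Notation "<| f , g |>" := (pair_to f g) (at level 0, f at level 99) : cart_scope.
Local Open Scope cart_scope.

Section CartTheory.
Variable V : cartcat.
Implicit Types a b c d : V.

Lemma pair_ext c a b (f g : hom c (prd a b)) :
  pr1 \oc f = pr1 \oc g -> pr2 \oc f = pr2 \oc g -> f = g.
Proof. by move=> e1 e2; rewrite (pairP f) (pairP g) e1 e2. Qed.

Lemma bang_eq a (f g : hom a (one : V)) : f = g.
Proof. by rewrite (bangP f) (bangP g). Qed.

Lemma pair_cmp d c a b (f : hom c a) (g : hom c b) (h : hom d c) :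
  <| f, g |> \oc h = <| f \oc h, g \oc h |>.
Proof.
by apply: pair_ext; rewrite -cmpA ?pr1_pair ?pr2_pair.
Qed.

Lemma pr1_pairK d c a b (f : hom c a) (g : hom c b) (h : hom d c) :
  pr1 \oc (<| f, g |> \oc h) = f \oc h.
Proof. by rewrite -cmpA pr1_pair. Qed.

Lemma pr2_pairK d c a b (f : hom c a) (g : hom c b) (h : hom d c) :
  pr2 \oc (<| f, g |> \oc h) = g \oc h.
Proof. by rewrite -cmpA pr2_pair. Qed.

Lemma bang_cmp a b (f : hom a b) : bang b \oc f = bang a.
Proof. exact: bang_eq. Qed.

Lemma pair_pr a b : <| pr1, pr2 |> = idc (prd a b).
Proof. by apply: pair_ext; rewrite ?pr1_pair ?pr2_pair cmpf1. Qed.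

End CartTheory.

Definition cartE := (cmpA, pair_cmp, pr1_pair, pr2_pair, pr1_pairK, pr2_pairK,
  pair_pr, cmp1f, cmpf1, bang_cmp).

(** Composition is in diagrammatic order. The carrier [eob] lies in a universe
    below that of [ob V]: enriched categories are small. *)
Record ecat (V : cartcat) := ECat {
  eob :> Type;
  ehom : eob -> eob -> V;
  eid : forall x, hom one (ehom x x);
  ecmp : forall x y z, hom (prd (ehom x y) (ehom y z)) (ehom x z);
  ecmpA : forall w x y z,
    ecmp w y z \oc <| ecmp w x y \oc pr1, pr2 |> =
    ecmp w x z \oc <| pr1 \oc pr1, ecmp x y z \oc <| pr2 \oc pr1, pr2 |> |>;
  ecmp1f : forall x y,
    ecmp x x y \oc <| eid x \oc bang _, idc (ehom x y) |> = idc (ehom x y);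
  ecmpf1 : forall x y,
    ecmp x y y \oc <| idc (ehom x y), eid y \oc bang _ |> = idc (ehom x y)
}.
Arguments eob {V} _.
Arguments ehom {V e} _ _.
Arguments eid {V e} x.
Arguments ecmp {V e} x y z.

Record efun (V : cartcat) (C D : ecat V) := EFun {
  fob :> C -> D;
  fhom : forall x y, hom (ehom x y) (ehom (fob x) (fob y));
  fhom1 : forall x, fhom x x \oc eid x = eid (fob x);
  fhomM : forall x y z,
    fhom x z \oc ecmp x y z =
    ecmp (fob x) (fob y) (fob z) \oc <| fhom x y \oc pr1, fhom y z \oc pr2 |>
}.
Arguments fob {V C D} _ _.
Arguments fhom {V C D} _ x y.

Section EnrichedCategories.
Variable V : cartcat.
Implicit Types C D : ecat V.

Lemma ecmpA_gen C (w x y z : C) c (f : hom c (ehom w x))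
  (g : hom c (ehom x y)) (h : hom c (ehom y z)) :
  ecmp w y z \oc <| ecmp w x y \oc <| f, g |>, h |> =
  ecmp w x z \oc <| f, ecmp x y z \oc <| g, h |> |>.
Proof.
have := congr1 (fun k => k \oc <| <| f, g |>, h |>) (ecmpA w x y z).
by rewrite /= !cartE.
Qed.

Lemma ecmp1f_gen C (x y : C) c (u : hom c one) (f : hom c (ehom x y)) :
  ecmp x x y \oc <| eid x \oc u, f |> = f.
Proof.
have := congr1 (fun k => k \oc f) (ecmp1f x y).
by rewrite /= !cartE (bangP u).
Qed.

Lemma ecmpf1_gen C (x y : C) c (u : hom c one) (f : hom c (ehom x y)) :
  ecmp x y y \oc <| f, eid y \oc u |> = f.
Proof.
have := congr1 (fun k => k \oc f) (ecmpf1 x y).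
by rewrite /= !cartE (bangP u).
Qed.

Definition ehom_cast D c (a a' b b' : D) (e : a = a') (e' : b = b')
  (f : hom c (ehom a b)) : hom c (ehom a' b') :=
  match e in _ = a1, e' in _ = b1 return hom c (ehom a1 b1) with
  | erefl, erefl => f
  end.

Lemma efun_ext C D (F G : efun C D) (e : forall x, F x = G x) :
  (forall x y, ehom_cast (e x) (e y) (fhom F x y) = fhom G x y) -> F = G.
Proof.
case: F G e => [F0 F1 F2 F3] [G0 G1 G2 G3] /= e.
have E : F0 = G0 by apply/funext.
subst G0 => h.
have E : F1 = G1.
  apply: functional_extensionality_dep => x.
  apply: functional_extensionality_dep => y.
  rewrite -h; by rewrite (Prop_irrelevance (e x) erefl) (Prop_irrelevance (e y) erefl).
subst G1; congr EFun; exact: Prop_irrelevance.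
Qed.

Definition efun_id C : efun C C.
Proof. by exists id (fun x y => idc _) => *; rewrite !cartE. Defined.

Definition efun_cmp C D E (G : efun D E) (F : efun C D) : efun C E.
Proof.
exists (fun x => G (F x)) (fun x y => fhom G _ _ \oc fhom F x y) => [x|x y z].
- by rewrite cmpA fhom1 fhom1.
- by rewrite cmpA fhomM -cmpA fhomM !cartE.
Defined.

Definition ecat_one : ecat V.
Proof.
by exists unit (fun _ _ => one) (fun _ => bang _) (fun _ _ _ => bang _) => *;
  apply: bang_eq.
Defined.

Definition efun_bang C : efun C ecat_one.
Proof.
by exists (fun _ => tt : ecat_one) (fun _ _ => bang _) => *; apply: bang_eq.
Defined.

Fact efun_bangP C (F : efun C ecat_one) : F = efun_bang C.
Proof.
have e x : F x = efun_bang C x by case: (F x).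
by apply: (efun_ext (e := e)) => x y; apply: bang_eq.
Qed.

(** No objects, hence no hom objects to give *)
Definition ecat_zero : ecat V.
Proof.
by exists Empty_set (fun x _ : Empty_set => match x with end)
  (fun x : Empty_set => match x with end)
  (fun x _ _ : Empty_set => match x with end) => -[].
Defined.

Definition ecat_prd C D : ecat V.
Proof.
exists (C * D)%type (fun p q => prd (ehom p.1 q.1) (ehom p.2 q.2))
  (fun p => <| eid p.1, eid p.2 |>)
  (fun p q r => <| ecmp p.1 q.1 r.1 \oc <| pr1 \oc pr1, pr1 \oc pr2 |>,
                   ecmp p.2 q.2 r.2 \oc <| pr2 \oc pr1, pr2 \oc pr2 |> |>).
- by move=> p q r s; apply: pair_ext; rewrite !cartE ecmpA_gen.
- by move=> p q; apply: pair_ext; rewrite !cartE ecmp1f_gen.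
- by move=> p q; apply: pair_ext; rewrite !cartE ecmpf1_gen.
Defined.

Definition efun_pr1 C D : efun (ecat_prd C D) C.
Proof.
by exists (fun p : ecat_prd C D => p.1) (fun _ _ => pr1) => *;
  rewrite /= !cartE.
Defined.

Definition efun_pr2 C D : efun (ecat_prd C D) D.
Proof.
by exists (fun p : ecat_prd C D => p.2) (fun _ _ => pr2) => *;
  rewrite /= !cartE.
Defined.

Definition efun_pair B C D (F : efun B C) (G : efun B D) :
  efun B (ecat_prd C D).
Proof.
exists (fun x => (F x, G x) : ecat_prd C D)
  (fun x y => <| fhom F x y, fhom G x y |>) => [x|x y z] /=.
- by rewrite !cartE !fhom1.
- by rewrite !cartE !fhomM.
Defined.

Fact ehom_cast_prd C D c (p q : ecat_prd C D)
  (ep : p = (p.1, p.2)) (eq : q = (q.1, q.2)) (f : hom c (ehom p q)) :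
  ehom_cast (D := ecat_prd C D) ep eq f =
  (<| pr1 \oc f, pr2 \oc f |> : hom c (prd _ _)).
Proof.
move: ep eq f; case: p => p1 p2; case: q => q1 q2 ep eq f.
rewrite (Prop_irrelevance ep erefl) (Prop_irrelevance eq erefl).
exact: (pairP (f : hom c (prd (ehom p1 q1) (ehom p2 q2)))).
Qed.

Fact efun_pairP B C D (H : efun B (ecat_prd C D)) :
  H = efun_pair (efun_cmp (efun_pr1 C D) H) (efun_cmp (efun_pr2 C D) H).
Proof.
set K := efun_pair _ _.
have e x : H x = K x by apply: surjective_pairing.
by apply: (efun_ext (e := e)) => x y; apply: ehom_cast_prd.
Qed.

Fact efun_cmpA B C D E (H : efun D E) (G : efun C D) (F : efun B C) :
  efun_cmp (efun_cmp H G) F = efun_cmp H (efun_cmp G F).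
Proof. by unshelve eapply efun_ext => [//|x y]; apply: cmpA. Qed.

Fact efun_cmp1f C D (F : efun C D) : efun_cmp (efun_id D) F = F.
Proof. by unshelve eapply efun_ext => [//|x y]; apply: cmp1f. Qed.

Fact efun_cmpf1 C D (F : efun C D) : efun_cmp F (efun_id C) = F.
Proof. by unshelve eapply efun_ext => [//|x y]; apply: cmpf1. Qed.

Fact efun_pr1_pair B C D (F : efun B C) (G : efun B D) :
  efun_cmp (efun_pr1 C D) (efun_pair F G) = F.
Proof. by unshelve eapply efun_ext => [//|x y]; apply: pr1_pair. Qed.

Fact efun_pr2_pair B C D (F : efun B C) (G : efun B D) :
  efun_cmp (efun_pr2 C D) (efun_pair F G) = G.
Proof. by unshelve eapply efun_ext => [//|x y]; apply: pr2_pair. Qed.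

Definition enriched : cartcat :=
  CartCat efun_cmpA efun_cmp1f efun_cmpf1 efun_bangP
          efun_pr1_pair efun_pr2_pair efun_pairP.

End EnrichedCategories.

Definition set_cat : cartcat.
Proof.
refine (@CartCat Type (fun A B => A -> B) (fun A => id) (fun A B C g f => g \o f)
  _ _ _ unit (fun _ _ => tt) _ prod (fun A B => fst) (fun A B => snd)
  (fun C A B f g x => (f x, g x)) _ _ _) => //.
- by move=> A f; apply/funext => x; case: (f x).
- by move=> C A B h; apply/funext => x; rewrite /= -surjective_pairing.
Defined.

(** [nCat n] is the category of strict [n]-categories, for [n >= 1]; sets serve
    as [0]-categories. *)
Fixpoint nCat (n : nat) : cartcat :=
  if n is m.+1 then enriched (nCat m) else set_cat.

Definition strict_cat (n : nat) : Type := nCat n.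

Definition objects (n : nat) (X : strict_cat n.+1) : Type :=
  eob (X : ecat (nCat n)).

Inductive susp_ob : Type := suspA | suspB.

Section Suspension.
Variables (V : cartcat) (X : ecat V).

Definition susp_hom (x y : susp_ob) : enriched V :=
  match x, y with
  | suspA, suspB => X
  | suspB, suspA => ecat_zero V
  | _, _ => one
  end.

Definition susp_id (x : susp_ob) : hom one (susp_hom x x) :=
  match x with suspA | suspB => idc one end.

Definition susp_cmp (x y z : susp_ob) :
  hom (prd (susp_hom x y) (susp_hom y z)) (susp_hom x z) :=
  match x, y, z with
  | suspA, suspA, suspB => pr2
  | suspA, suspB, suspB => pr1
  | suspB, suspA, suspA => pr1
  | suspB, suspB, suspA => pr2
  | suspA, _, suspA => bang _
  | suspB, _, suspB => bang _
  end.

Fact susp_zero_eq (c d : enriched V) (h : hom c (ecat_zero V : enriched V))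
  (f g : hom c d) : f = g.
Proof.
have e x : fob f x = fob g x by case: (fob h x).
by apply: (efun_ext (e := e)) => x; case: (fob h x).
Qed.

Definition susp : ecat (enriched V).
Proof.
exists susp_ob susp_hom susp_id susp_cmp.
- case=> -[] [] [];
    cbn [susp_hom susp_id susp_cmp]; rewrite ?cartE //;
    try exact: bang_eq; apply: susp_zero_eq;
    first [exact: pr2 | exact: (pr2 \oc pr1) | exact: (pr1 \oc pr1)].
- by case=> -[]; cbn [susp_hom susp_id susp_cmp]; rewrite ?cartE //;
    apply: bang_eq.
- by case=> -[]; cbn [susp_hom susp_id susp_cmp]; rewrite ?cartE //;
    apply: bang_eq.
Defined.

End Suspension.

Definition suspension (n : nat) (X : strict_cat n.+1) : strict_cat n.+2 :=
  susp (X : ecat (nCat n)).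

(** The structure maps of a strong symmetric monoidal functor
    [V -> Ab] that enter the magnitude nerve: the action on objects and
    morphisms, [S a (x) S b -> S (a x b)], and [Z -> S 1] with its inverse.
    Only data are recorded: every instance used below is an explicit
    construction, determined by these maps. *)
Record coef (V : cartcat) := Coef {
  cval :> V -> zmodType;
  cmap : forall a b, hom a b -> {additive cval a -> cval b};
  cmu : forall a b, {additive tensor (cval a) (cval b) -> cval (prd a b)};
  ceta : {additive int -> cval one};
  ceps : {additive cval one -> int}
}.
Arguments cmap {V} _ {a b} _.
Arguments cmu {V} _ a b.
Arguments ceta {V} _.
Arguments ceps {V} _.

Definition free_coef : coef set_cat :=
  @Coef set_cat (fun S : Type => free_ab S)
    (fun S T (f : S -> T) => free_lift (fun s => free_gen (f s)))
    (fun S T : Type => free_mu S T)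
    (int_scale (free_gen tt))
    (free_lift (fun _ : unit => 1)).

(** A functor [V -> [Delta^op, Ab]] with the same structure maps, which for the
    pointwise tensor product are given levelwise. *)
Record scoef (V : cartcat) := SCoef {
  slevel :> nat -> coef V;
  sface : forall m (i : 'I_m.+2) (a : V),
    {additive slevel m.+1 a -> slevel m a};
  sdegen : forall m (i : 'I_m.+1) (a : V),
    {additive slevel m a -> slevel m.+1 a}
}.
Arguments sface {V} _ {m} i a.
Arguments sdegen {V} _ {m} i a.

Fixpoint tup (T : Type) (m : nat) : Type :=
  if m is m'.+1 then (T * tup T m')%type else unit.

Fixpoint tup_map (T U : Type) (f : T -> U) (m : nat) : tup T m -> tup U m :=
  match m with
  | 0 => id
  | m'.+1 => fun p => (f p.1, tup_map f p.2)
  end.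

Fixpoint tup_zip (T U : Type) (m : nat) : tup T m -> tup U m -> tup (T * U) m :=
  match m with
  | 0 => fun _ _ => tt
  | m'.+1 => fun p q => ((p.1, q.1), tup_zip p.2 q.2)
  end.

Fixpoint tup_const (T : Type) (t : T) (m : nat) : tup T m :=
  if m is m'.+1 then (t, tup_const t m') else tt.

(** Deletes the entry of index [i <= m]. *)
Fixpoint tup_del (T : Type) (m i : nat) : tup T m.+1 -> tup T m :=
  match m, i with
  | _, 0 => fun p => p.2
  | 0, _ => fun _ => tt
  | m'.+1, i'.+1 => fun p => (p.1, tup_del i' p.2)
  end.

(** Repeats the entry of index [i <= m]; defined through its tail, so that its
    head is the head of the argument by computation. *)
Fixpoint tup_dup_tail (T : Type) (m i : nat) : tup T m.+1 -> tup T m.+1 :=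
  match m, i with
  | _, 0 => fun p => p
  | 0, _ => fun p => p
  | m'.+1, i'.+1 => fun p => (p.2.1, tup_dup_tail i' p.2)
  end.

Definition tup_dup (T : Type) (m i : nat) (p : tup T m.+1) : tup T m.+2 :=
  (p.1, tup_dup_tail i p).

Section MagnitudeNerve.
Variables (V : cartcat) (S : coef V).

Section OneCategory.
Variable X : ecat V.

(** The tensor product [S X(x0,x1) (x) .. (x) S X(x_{m-1},xm)], bracketed to the
    right and ending in the unit [Z], so that it is [Z] for [m = 0]. *)
Fixpoint chain (m : nat) : tup X m.+1 -> zmodType :=
  match m with
  | 0 => fun _ => int
  | m'.+1 => fun p => tensor (S (ehom p.1 p.2.1)) (@chain m' p.2)
  end.

(** [S X(x,y) -> S 1 ~ Z] *)
Definition chain_drop (x y : X) : {additive S (ehom x y) -> int} :=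
  acomp (ceps S) (cmap S (bang (ehom x y))).

(** [S X(x,y) (x) S X(y,z) -> S (X(x,y) x X(y,z)) -> S X(x,z)] *)
Definition chain_cmp (x y z : X) :
  {additive tensor (S (ehom x y)) (S (ehom y z)) -> S (ehom x z)} :=
  acomp (cmap S (ecmp x y z)) (cmu S _ _).

(** Face [i] out of degree [m.+1]: the outer faces are [i = 0] and [i = m.+1],
    the latter reached in the second branch at the end of the recursion. *)
Fixpoint chain_face (m i : nat) : forall p : tup X m.+2,
    {additive @chain m.+1 p -> chain (tup_del i p)} :=
  match m, i return forall p : tup X m.+2,
    {additive @chain m.+1 p -> chain (tup_del i p)} with
  | m', 0 => fun p => tensor_unitl (@chain m' p.2) (chain_drop p.1 p.2.1)
  | 0, _.+1 => fun p => tensor_unitl int (chain_drop p.1 p.2.1)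
  | m'.+1, 1 => fun p =>
      acomp (tensor_map (chain_cmp p.1 p.2.1 p.2.2.1) (aid (@chain m' p.2.2)))
            (tensor_assoc _ _ _)
  | m'.+1, i'.+2 => fun p =>
      tensor_map (aid (S (ehom p.1 p.2.1))) (@chain_face m' i'.+1 p.2)
  end.

Definition chain_unit (x : X) : S (ehom x x) := cmap S (eid x) (ceta S 1).

Fixpoint chain_degen (m i : nat) : forall p : tup X m.+1,
    {additive @chain m p -> @chain m.+1 (tup_dup i p)} :=
  match m, i return forall p : tup X m.+1,
    {additive @chain m p -> @chain m.+1 (tup_dup i p)} with
  | m', 0 => fun p => tens_with (@chain m' p) (chain_unit p.1)
  | 0, _.+1 => fun p => tens_with int (chain_unit p.1)
  | m'.+1, i'.+1 => fun p =>
      tensor_map (aid (S (ehom p.1 p.2.1))) (@chain_degen m' i' p.2)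
  end.

Definition MBgroup (m : nat) : zmodType := dsum (@chain m).

Definition MBface (m i : nat) : {additive MBgroup m.+1 -> MBgroup m} :=
  dsum_map (@chain_face m i).

Definition MBdegen (m i : nat) : {additive MBgroup m -> MBgroup m.+1} :=
  dsum_map (@chain_degen m i).

End OneCategory.

Fixpoint chain_map (X Y : ecat V) (F : efun X Y) (m : nat) :
    forall p : tup X m.+1, {additive chain p -> chain (tup_map F p)} :=
  match m return forall p : tup X m.+1,
    {additive chain p -> chain (tup_map F p)} with
  | 0 => fun _ => aid int
  | m'.+1 => fun p =>
      tensor_map (cmap S (fhom F p.1 p.2.1)) (@chain_map X Y F m' p.2)
  end.

Fixpoint chain_zip (X Y : ecat V) (m : nat) :
    forall (p : tup X m.+1) (q : tup Y m.+1),
    {additive tensor (chain p) (chain q)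
              -> @chain (ecat_prd X Y) m (tup_zip p q)} :=
  match m return forall (p : tup X m.+1) (q : tup Y m.+1),
    {additive tensor (chain p) (chain q)
              -> @chain (ecat_prd X Y) m (tup_zip p q)} with
  | 0 => fun _ _ => tensor_unitl int (aid int)
  | m'.+1 => fun p q =>
      acomp (tensor_map (cmu S (ehom p.1 p.2.1) (ehom q.1 q.2.1))
                        (@chain_zip X Y m' p.2 q.2))
            (tensor_swap _ _ _ _)
  end.

Fixpoint chain_eta (m : nat) : @chain (ecat_one V) m (tup_const tt m.+1) :=
  match m with
  | 0 => 1 : int
  | m'.+1 => tens (ceta S 1) (chain_eta m')
  end.

Fixpoint chain_eps (m : nat) :
    forall p : tup (ecat_one V) m.+1, {additive chain p -> int} :=
  match m return forall p : tup (ecat_one V) m.+1, {additive chain p -> int} with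
  | 0 => fun _ => aid int
  | m'.+1 => fun p =>
     acomp (@chain_eps m' p.2) (tensor_unitl (chain p.2) (ceps S))
  end.

Definition MBcoef (m : nat) : coef (enriched V) :=
  @Coef (enriched V) (fun X : ecat V => MBgroup X m)
    (fun (X Y : ecat V) (F : efun X Y) => dsum_map (chain_map F (m := m)))
    (fun X Y : ecat V => dsum_tensor (@chain_zip X Y m))
    (int_scale (dsum_in (@chain (ecat_one V) m) _ (chain_eta m)))
    (dsum_lift (@chain_eps m)).

Definition MBs : scoef (enriched V) :=
  @SCoef (enriched V) MBcoef
    (fun m i (X : ecat V) => MBface X m i)
    (fun m i (X : ecat V) => MBdegen X m i).

End MagnitudeNerve.

Fixpoint chain_nat (V : cartcat) (S S' : coef V)
    (phi : forall a, {additive S a -> S' a}) (X : ecat V) (m : nat) :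
    forall p : tup X m.+1, {additive chain S p -> chain S' p} :=
  match m return forall p : tup X m.+1, {additive chain S p -> chain S' p} with
  | 0 => fun _ => aid int
  | m'.+1 => fun p =>
      tensor_map (phi (ehom p.1 p.2.1)) (@chain_nat V S S' phi X m' p.2)
  end.

Definition MBnat (V : cartcat) (S S' : coef V)
  (phi : forall a, {additive S a -> S' a}) (X : ecat V) (m : nat) :
  {additive MBgroup S X m -> MBgroup S' X m} := dsum_map (chain_nat phi (m := m)).

(** For coefficients [S] in [[Delta^op, Ab]], direct sums and tensor products
    are pointwise, so the bisimplicial group [MB^S(X)] is [MB^(S p)(X)] in
    internal degree [p]; its internal faces and degeneracies come from those of
    [S]. This is its diagonal. *)
Definition MBdiag (V : cartcat) (S : scoef V) : scoef (enriched V) :=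
  @SCoef (enriched V) (fun m => MBcoef (S m) m)
    (fun m i (X : ecat V) =>
       acomp (MBface (S m) X m i) (MBnat (sface S i) X m.+1))
    (fun m i (X : ecat V) =>
       acomp (MBdegen (S m.+1) X m i) (MBnat (sdegen S i) X m)).

(** The index is shifted by one: [MB n] is the nerve of strict
    [n.+1]-categories, so [MB 0] is the nerve of categories. *)
Fixpoint MB (n : nat) : scoef (nCat n.+1) :=
  if n is m.+1 then MBdiag (MB m) else MBs free_coef.

Section Homology.
Variables (A : nat -> zmodType)
  (face : forall m, 'I_m.+2 -> {additive A m.+1 -> A m}).

Definition diff (m : nat) (x : A m.+1) : A m :=
  \sum_(i < m.+2) face i x *~ (-1) ^+ i.

Fact diffB m : zmod_morphism (@diff m).
Proof.
move=> x y; rewrite /diff -sumrB; apply: eq_bigr => i _.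
by rewrite raddfB mulrzBl.
Qed.

HB.instance Definition _ m := GRing.isZmodMorphism.Build _ _ (@diff m) (@diffB m).

Definition is_cycle (k : nat) : A k -> bool :=
  match k with
  | 0 => fun _ => true
  | m.+1 => fun x : A m.+1 => diff x == 0
  end.

Fact is_cycle_zmod k : zmod_closed (@is_cycle k).
Proof.
case: k => [|m]; split=> //=; first by rewrite unfold_in /= raddf0.
by move=> x y; rewrite !unfold_in /= => /eqP ex /eqP ey;
  rewrite diffB ex ey subr0.
Qed.

HB.instance Definition _ k :=
  GRing.isZmodClosed.Build (A k) (@is_cycle k) (@is_cycle_zmod k).

Record cycle (k : nat) := Cycle { cycle_val :> A k; _ : is_cycle cycle_val }.

HB.instance Definition _ k := [isSub for @cycle_val k].
HB.instance Definition _ k := [Choice of cycle k by <:].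
HB.instance Definition _ k := [SubChoice_isSubZmodule of cycle k by <:].

(** The cycles that bound; for a simplicial abelian group, where [diff] squares
    to zero, these are all the boundaries. *)
Definition is_boundary (k : nat) : cycle k -> bool :=
  fun c => `[< exists y : A k.+1, val c = diff y >].

Fact is_boundary_zmod k : zmod_closed (@is_boundary k).
Proof.
split=> [|x y]; rewrite !unfold_in.
  by apply/asboolP; exists 0; rewrite raddf0 raddf0.
move=> /asboolP[u ex] /asboolP[v ey]; apply/asboolP; exists (u - v).
by rewrite !raddfB /= -ex -ey.
Qed.

HB.instance Definition _ k :=
  GRing.isZmodClosed.Build (cycle k) (@is_boundary k) (@is_boundary_zmod k).

Definition homology (k : nat) : zmodType :=
  Quotient.quot (GRing.ZmodClosed.clone (cycle k) (@is_boundary k) _).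

End Homology.

(** The magnitude homology of a strict [n.+1]-category *)
Definition MH (n : nat) (X : strict_cat n.+1) (k : nat) : zmodType :=
  @homology (fun m => MB n m X) (fun m i => sface (MB n) i X) k.

(* Main.v *)
From HB Require Import structures.
From mathcomp Require Import all_boot all_order all_algebra.
From mathcomp Require Import boolp zify.
Require Import Defs.

(** The magnitude nerve of a strict n-category is the free simplicial abelian
    group on a simplicial set, its multinerve: the free abelian group functor
    takes products to tensor products and disjoint unions to direct sums, so
    each enriched nerve and each diagonal can be formed on sets first. This is
    [multinerve_basis], and [MH_simplices] draws the consequence for homology.
    The simplicial identities are then proved for sets, where the coefficient
    functors preserve products and coherence comes for free.

    Let Y be the multinerve of X. A simplex of the multinerve of the suspension
    has vertices A, .., A, B, .., B because nothing maps from B to A; the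
    endomorphism objects of A and B are terminal, so the only datum is the
    simplex of Y on the one arrow from A to B, absent when A or B does not
    occur. Hence the multinerve of the suspension is the unreduced suspension of
    Y, the product of Y and the interval with both ends collapsed to points
    ([susp_simplex], [nface_susp], [susp_decK]).

    It remains to compute the homology of an unreduced suspension U. The shuffle
    product with the interval sends chains of Y to chains of U one degree
    higher; a one-sided inverse is [desusp], which keeps the last face of the
    simplices with a single vertex B. The contraction of Y times the interval
    towards B is a chain homotopy on U between the identity and, up to sign,
    [shuffle] after [desusp], apart from the cone point B ([cone_diff]). On
    chains of augmentation zero both maps commute with differentials up to sign,
    and [desusp] after [shuffle] is a sign ([desusp_shuffle]). So the homology
    of U in degree k >= 1 is that of the kernel of the augmentation of the
    chains of Y in degree k - 1. A base point, which exists because X is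
    nonempty, splits off the augmentation: it accounts for one copy of the
    integers in degree 0 and for nothing above. *)

Set Implicit Arguments.
Unset Strict Implicit.
Unset Printing Implicit Defensive.

Import GRing.Theory.

(** * Product-preserving functors to sets *)

(** A functor to sets that preserves finite products: [pmu] inverts the
    comparison map [T (a x b) -> T a x T b], and [T] of the terminal object is a
    point. All coherence (naturality, associativity and units of [pmu]) follows
    from these inversion laws. *)
Record pfun (V : cartcat) := PFun {
  pval :> V -> Type;
  pmap : forall a b, hom a b -> pval a -> pval b;
  pmap1 : forall a s, pmap (idc a) s = s;
  pmapM : forall a b c (g : hom b c) (f : hom a b) s,
    pmap (g \oc f) s = pmap g (pmap f s);
  pmu : forall a b, pval a -> pval b -> pval (prd a b);
  pmu1 : forall a b s t, pmap (pr1 : hom (prd a b) a) (pmu s t) = s;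
  pmu2 : forall a b s t, pmap (pr2 : hom (prd a b) b) (pmu s t) = t;
  pmu_eta : forall a b u,
    pmu (pmap (pr1 : hom (prd a b) a) u) (pmap (pr2 : hom (prd a b) b) u) = u;
  punit : pval one;
  punitP : forall t, t = punit
}.
Arguments pmap {V} _ {a b} _ _.
Arguments pmu {V} _ {a b} _ _.
Arguments punit {V} _.

Section ProductFunctor.
Local Open Scope cart_scope.
Variables (V : cartcat) (T : pfun V).

Lemma pmap_pair c a b (f : hom c a) (g : hom c b) s :
  pmap T <| f, g |> s = pmu T (pmap T f s) (pmap T g s).
Proof. by rewrite -[LHS]pmu_eta -!pmapM pr1_pair pr2_pair. Qed.

Lemma pmap_bang a (s : T a) : pmap T (bang a) s = punit T.
Proof. exact: punitP. Qed.

(** A product-preserving functor turns an enriched category into an ordinary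
    one, with hom sets [T (ehom x y)]; enriched functors and natural maps induce
    functors. *)
Section Composition.
Variable X : ecat V.

Definition pid (x : X) : T (ehom x x) := pmap T (eid x) (punit T).

Definition pcomp (x y z : X) (f : T (ehom x y)) (g : T (ehom y z)) :
  T (ehom x z) := pmap T (ecmp x y z) (pmu T f g).

Lemma pcompA (w x y z : X) (f : T (ehom w x)) (g : T (ehom x y))
  (h : T (ehom y z)) : pcomp (pcomp f g) h = pcomp f (pcomp g h).
Proof.
have := congr1 (fun k => pmap T k (pmu T (pmu T f g) h)) (ecmpA w x y z).
by rewrite /pcomp /= !(pmapM, pmap_pair, pmu1, pmu2).
Qed.

Lemma pcomp1f (x y : X) (f : T (ehom x y)) : pcomp (pid x) f = f.
Proof.
have := congr1 (fun k => pmap T k f) (ecmp1f x y).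
by rewrite /pcomp /pid /= !(pmapM, pmap_pair, pmap_bang, pmap1).
Qed.

Lemma pcompf1 (x y : X) (f : T (ehom x y)) : pcomp f (pid y) = f.
Proof.
have := congr1 (fun k => pmap T k f) (ecmpf1 x y).
by rewrite /pcomp /pid /= !(pmapM, pmap_pair, pmap_bang, pmap1).
Qed.

End Composition.

Lemma pmap_pid (X Y : ecat V) (F : efun X Y) x :
  pmap T (fhom F x x) (pid x) = pid (F x).
Proof. by rewrite /pid -pmapM fhom1. Qed.

Lemma pmap_pcomp (X Y : ecat V) (F : efun X Y) x y z
    (f : T (ehom x y)) (g : T (ehom y z)) :
  pmap T (fhom F x z) (pcomp f g) =
  pcomp (pmap T (fhom F x y) f) (pmap T (fhom F y z) g).
Proof.
by rewrite /pcomp -!pmapM fhomM pmapM pmap_pair !pmapM pmu1 pmu2.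
Qed.

End ProductFunctor.

(** Only naturality is asked for: compatibility with [pmu] is automatic because
    [pmu] inverts a natural map. *)
Record pnat (V : cartcat) (T T' : pfun V) := PNat {
  papp : forall a, T a -> T' a;
  pappM : forall a b (f : hom a b) s, papp (pmap T f s) = pmap T' f (papp s)
}.
Arguments papp {V T T'} _ {a} _.

Section NaturalMaps.
Variables (V : cartcat) (T T' : pfun V) (phi : pnat T T').

Lemma papp_mu a b (s : T a) (t : T b) :
  papp phi (pmu T s t) = pmu T' (papp phi s) (papp phi t).
Proof. by rewrite -[LHS]pmu_eta -!pappM pmu1 pmu2. Qed.

Lemma papp_pcomp (X : ecat V) (x y z : X)
    (f : T (ehom x y)) (g : T (ehom y z)) :
  papp phi (pcomp f g) = pcomp (papp phi f) (papp phi g).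
Proof. by rewrite /pcomp pappM papp_mu. Qed.

Lemma papp_pid (X : ecat V) (x : X) : papp phi (pid T x) = pid T' x.
Proof. by rewrite /pid pappM [papp phi (punit T)]punitP. Qed.

End NaturalMaps.

(** * The nerve of an enriched category with set-valued coefficients *)

Section Nerve.
Variable V : cartcat.

(** Strings of [m] composable arrows out of [x]. Recording each target next to
    its arrow, instead of first choosing all vertices, keeps faces and
    degeneracies free of transports, so that the simplicial identities hold by
    structural induction. *)
Fixpoint path (T : pfun V) (X : ecat V) (m : nat) (x : X) : Type :=
  if m is m'.+1 then {y : X & (T (ehom x y) * path T m' y)%type} else unit.

Definition pcons (T : pfun V) (X : ecat V) m (x y : X) (f : T (ehom x y))
  (q : path T m y) : path T m.+1 x := existT _ y (f, q).

Definition nerve (T : pfun V) (X : ecat V) (m : nat) := {x : X & path T m x}.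

Section Structure.
Variables (T : pfun V) (X : ecat V).

(** Removal of the vertex of index [i.+1], which composes two arrows or drops
    the last one; the source [x] stays. *)
Fixpoint pface (m i : nat) : forall x : X, path T m.+1 x -> path T m x :=
  match m, i return forall x : X, path T m.+1 x -> path T m x with
  | 0, _ => fun x _ => tt
  | m'.+1, 0 => fun x p =>
      let: existT y (f, existT z (g, q)) := p in pcons (pcomp f g) q
  | m'.+1, i'.+1 => fun x p =>
      let: existT y (f, q) := p in pcons f (pface i' q)
  end.

Definition nface (m i : nat) (p : nerve T X m.+1) : nerve T X m :=
  let: existT x q := p in
  if i is i'.+1 then existT _ x (pface i' q)
  else existT _ (tag q) (tagged q).2.

Fixpoint pdegen (m i : nat) : forall x : X, path T m x -> path T m.+1 x :=
  match m, i return forall x : X, path T m x -> path T m.+1 x with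
  | _, 0 => fun x p => pcons (pid T x) p
  | 0, _ => fun x p => pcons (pid T x) p
  | m'.+1, i'.+1 => fun x p =>
      let: existT y (f, q) := p in pcons f (pdegen i' q)
  end.

Definition ndegen (m i : nat) (p : nerve T X m) : nerve T X m.+1 :=
  existT _ (tag p) (pdegen i (tagged p)).

Lemma path0 (x : X) (p q : path T 0 x) : p = q.
Proof. by case: p q => -[]. Qed.

Lemma pface_pface m i j x (p : path T m.+2 x) : i < j ->
  pface i (pface j p) = pface j.-1 (pface i p).
Proof.
elim: m i j x p => [|m IH] i j x p; first by move=> _; apply: path0.
case: i j p => [|i] [|j] // [y [f q]] ij.
  case: j ij q => [|j] ij [z [g q]] //.
  by case: q => w [h q] /=; rewrite pcompA.
by case: j ij => [//|j] ij; congr (pcons f _); exact: (IH i j.+1 y q).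
Qed.

Lemma nface_nface m i j (p : nerve T X m.+2) : i < j ->
  nface i (nface j p) = nface j.-1 (nface i p).
Proof.
case: p => x p; case: i j => [|i] [|j] // ij.
  by case: p => y [f q]; case: j ij => [|j] ij //=; case: q => z [g q].
by case: j ij => [|j] // ij; congr existT; apply: (pface_pface p).
Qed.

Lemma pface_pdegen_id m i j x (p : path T m x) : (j == i) || (j == i.+1) ->
  pface i (pdegen j p) = p.
Proof.
elim: m i j x p => [|m IH] i j x p; first by move=> _; apply: path0.
case: i j p => [|i] [|j] // [y [f q]] ij.
- by rewrite /= pcomp1f.
- case: j ij => [|j] // _.
  by case: m {IH} q => [|m] q /=; rewrite pcompf1.
- by congr (pcons f _); apply: IH.
Qed.

Lemma pface_pdegen_lt m i j x (p : path T m.+1 x) : i.+1 < j <= m.+1 ->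
  pface i (pdegen j p) = pdegen j.-1 (pface i p).
Proof.
elim: m i j x p => [|m IH] i [|j] x p //; first by case: j => [|j] /andP[].
case: i j p => [|i] [|j] // [y [f q]] ij.
  by case: j ij q => [|j] ij // [z [g q]].
by congr (pcons f _); apply: (IH i j.+1).
Qed.

Lemma pface_pdegen_gt m i j x (p : path T m.+1 x) : j < i -> j <= m ->
  pface i (pdegen j p) = pdegen j (pface i.-1 p).
Proof.
elim: m i j x p => [|m IH] [|i] [|j] x p // ij jm.
case: p => y [f q]; case: i ij => [|i] // ij.
by congr (pcons f _); apply: (IH i.+1 j).
Qed.

Lemma nface_ndegen_id m i j (p : nerve T X m) : (i == j) || (i == j.+1) ->
  nface i (ndegen j p) = p.
Proof.
case: p => x p; case: i => [|i] ij.
  by case: j ij p => // _; case: m.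
by congr existT; apply: pface_pdegen_id; rewrite !(eq_sym j) orbC.
Qed.

Lemma nface_ndegen_lt m i j (p : nerve T X m.+1) : i < j <= m.+1 ->
  nface i (ndegen j p) = ndegen j.-1 (nface i p).
Proof.
case: p => x p; case: i => [|i] ij; last by congr existT; apply: pface_pdegen_lt.
by case: j ij p => [|j] // _ [y [f q]].
Qed.

Lemma nface_ndegen_gt m i j (p : nerve T X m.+1) : j.+1 < i <= m.+2 ->
  nface i (ndegen j p) = ndegen j (nface i.-1 p).
Proof.
case: p => x p; case: i => [|[|i]] // /andP[ji im].
by congr existT; rewrite (pface_pdegen_gt p) //; apply: leq_trans ji im.
Qed.

End Structure.

Fixpoint pathmap (T : pfun V) (X Y : ecat V) (F : efun X Y) (m : nat) :
    forall x : X, path T m x -> path T m (F x) :=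
  match m return forall x : X, path T m x -> path T m (F x) with
  | 0 => fun _ _ => tt
  | m'.+1 => fun x p =>
      let: existT y (f, q) := p in
      pcons (pmap T (fhom F x y) f) (pathmap F q)
  end.

Definition nervemap (T : pfun V) (X Y : ecat V) (F : efun X Y) (m : nat)
  (p : nerve T X m) : nerve T Y m := existT _ (F (tag p)) (pathmap F (tagged p)).

Lemma nervemap_face (T : pfun V) (X Y : ecat V) (F : efun X Y) m i
    (p : nerve T X m.+1) : nface i (nervemap F p) = nervemap F (nface i p).
Proof.
case: p => x p; case: i => [|i]; first by case: p => y [f q].
congr existT; elim: m i x p => [|m IH] [|i] x p //; case: p => y [f q].
  by case: q => z [g q] /=; rewrite pmap_pcomp.
exact: (congr1 (pcons _) (IH i _ q)).
Qed.

Lemma nervemap_degen (T : pfun V) (X Y : ecat V) (F : efun X Y) m i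
    (p : nerve T X m) : ndegen i (nervemap F p) = nervemap F (ndegen i p).
Proof.
case: p => x p; congr existT.
elim: m i x p => [|m IH] [|i] x p; rewrite /= ?pmap_pid //.
case: p => y [f q]; exact: (congr1 (pcons _) (IH i _ q)).
Qed.

Section Coefficients.
Variables (T T' : pfun V) (phi : pnat T T') (X : ecat V).

Fixpoint pathnat (m : nat) : forall x : X, path T m x -> path T' m x :=
  match m return forall x : X, path T m x -> path T' m x with
  | 0 => fun _ _ => tt
  | m'.+1 => fun x p =>
      let: existT y (f, q) := p in pcons (papp phi f) (pathnat q)
  end.

Definition nervenat m (p : nerve T X m) : nerve T' X m :=
  existT _ (tag p) (pathnat (tagged p)).

Lemma nervenat_face m i (p : nerve T X m.+1) :
  nface i (nervenat p) = nervenat (nface i p).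
Proof.
case: p => x p; case: i => [|i]; first by case: p => y [f q].
congr existT; elim: m i x p => [|m IH] [|i] x p //; case: p => y [f q].
  by case: q => z [g q] /=; rewrite papp_pcomp.
exact: (congr1 (pcons _) (IH i _ q)).
Qed.

Lemma nervenat_degen m i (p : nerve T X m) :
  ndegen i (nervenat p) = nervenat (ndegen i p).
Proof.
case: p => x p; congr existT.
elim: m i x p => [|m IH] [|i] x p; rewrite /= ?papp_pid //.
case: p => y [f q]; exact: (congr1 (pcons _) (IH i _ q)).
Qed.

End Coefficients.

Lemma nervenat_comp (T T1 T' : pfun V) (phi : pnat T T1) (psi : pnat T1 T')
    (chi : pnat T T') (X : ecat V) m (p : nerve T X m) :
  (forall a (s : T a), papp psi (papp phi s) = papp chi s) ->
  nervenat psi (nervenat phi p) = nervenat chi p.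
Proof.
move=> e; case: p => x p; congr existT.
by elim: m x p => [|m IH] x p //; case: p => y [f q]; rewrite /= e IH.
Qed.

Lemma nervenat_id (T : pfun V) (phi : pnat T T) (X : ecat V) m
    (p : nerve T X m) :
  (forall a (s : T a), papp phi s = s) -> nervenat phi p = p.
Proof.
move=> e; case: p => x p; congr existT.
by elim: m x p => [|m IH] x p; case: p => // y [f q]; rewrite /= e IH.
Qed.

Lemma nervemap_nat (T T' : pfun V) (phi : pnat T T') (X Y : ecat V)
    (F : efun X Y) m (p : nerve T X m) :
  nervenat phi (nervemap F p) = nervemap F (nervenat phi p).
Proof.
case: p => x p; congr existT.
by elim: m x p => [|m IH] x p //; case: p => y [f q]; rewrite /= pappM IH.
Qed.

End Nerve.

Section NerveFunctor.
Variables (V : cartcat) (T : pfun V) (m : nat).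

Fixpoint pathzip (X Y : ecat V) (m : nat) : forall (x : X) (y : Y),
    path T m x -> path T m y -> path (X := ecat_prd X Y) T m (x, y) :=
  match m return forall (x : X) (y : Y),
    path T m x -> path T m y -> path (X := ecat_prd X Y) T m (x, y) with
  | 0 => fun _ _ _ _ => tt
  | m'.+1 => fun x y p q =>
      let: existT x' (f, p') := p in let: existT y' (g, q') := q in
      pcons (X := ecat_prd X Y) (x := (x, y)) (y := (x', y'))
        (pmu T f g : T (ehom ((x, y) : ecat_prd X Y) (x', y')))
        (pathzip p' q')
  end.

Lemma pathzip_eta (X Y : ecat V) k (x : X) (y : Y)
    (p : path (X := ecat_prd X Y) T k (x, y)) :
  pathzip (pathmap (efun_pr1 X Y) p : path T k x)
          (pathmap (efun_pr2 X Y) p : path T k y) = p.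
Proof.
elim: k x y p => [|k IH] x y; first by case.
case=> -[x' y'] [f q].
exact: (f_equal2 (@pcons V T (ecat_prd X Y) k (x, y) (x', y'))
  (pmu_eta f) (IH x' y' q)).
Qed.

Definition nervezip (X Y : ecat V) (p : nerve T X m) (q : nerve T Y m) :
  nerve T (ecat_prd X Y) m :=
  existT _ (tag p, tag q) (pathzip (tagged p) (tagged q)).

Fixpoint pathconst (m : nat) (x : ecat_one V) : path (X := ecat_one V) T m x :=
  if m is m'.+1 then pcons (x := x) (y := tt : ecat_one V)
    (punit T : T (ehom x (tt : ecat_one V))) (pathconst m' tt) else tt.

(** A string in a product category is a pair of strings, and the terminal
    category has one string of each length, so the nerve in a fixed degree again
    preserves products. This is what lets the construction be iterated. *)
Definition nervepfun : pfun (enriched V).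
Proof.
refine (@PFun (enriched V) (fun X : ecat V => nerve T X m)
  (fun X Y F => nervemap F (m := m)) _ _ nervezip _ _ _
  (existT _ (tt : ecat_one V) (pathconst m tt)) _).
- move=> X [x p]; congr existT.
  by elim: m x p => [|k IH] x p; case: p => // y [f q]; rewrite /= pmap1 IH.
- move=> X Y Z G F [x p]; congr existT.
  by elim: m x p => [|k IH] x p //; case: p => // y [f q]; rewrite /= pmapM IH.
- move=> X Y [x p] [y q]; rewrite /nervezip; congr existT; move=> /=.
  elim: m x p y q => [|k IH] x p y q; first by case: p.
  by case: p q => x' [f p] [y' [g q]]; rewrite /= pmu1 IH.
- move=> X Y [x p] [y q]; rewrite /nervezip; congr existT; move=> /=.
  elim: m x p y q => [|k IH] x p y q; first by case: q.
  by case: p q => x' [f p] [y' [g q]]; rewrite /= pmu2 IH.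
- move=> X Y [[x y] p].
  exact: (congr1 (existT (fun z : ecat_prd X Y => path T m z) (x, y))
    (pathzip_eta p)).
- case=> -[] p; congr existT.
  elim: m p => [|k IH] p; first by case: p.
  by case: p => -[] [f p]; rewrite /= [f]punitP (IH p).
Defined.

End NerveFunctor.

(** * The multinerve of a strict higher category *)

(** A simplicial object in product-preserving functors. Indices are plain
    natural numbers. For nerves an index beyond the last vertex acts as the last
    one, under which [ddegen_lt] and [ddegen_gt] fail; hence their upper
    bounds. *)
Record spfun (V : cartcat) := SPFun {
  slev :> nat -> pfun V;
  dface : forall m, nat -> pnat (slev m.+1) (slev m);
  ddegen : forall m, nat -> pnat (slev m) (slev m.+1);
  dfaceK : forall m i j a (s : slev m.+2 a), i < j ->
    papp (dface m i) (papp (dface m.+1 j) s) =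
    papp (dface m j.-1) (papp (dface m.+1 i) s);
  ddegenK : forall m i j a (s : slev m a), (i == j) || (i == j.+1) ->
    papp (dface m i) (papp (ddegen m j) s) = s;
  ddegen_lt : forall m i j a (s : slev m.+1 a), i < j <= m.+1 ->
    papp (dface m.+1 i) (papp (ddegen m.+1 j) s) =
    papp (ddegen m j.-1) (papp (dface m i) s);
  ddegen_gt : forall m i j a (s : slev m.+1 a), j.+1 < i <= m.+2 ->
    papp (dface m.+1 i) (papp (ddegen m.+1 j) s) =
    papp (ddegen m j) (papp (dface m i.-1) s)
}.
Arguments dface {V} _ {m} i.
Arguments ddegen {V} _ {m} i.

Arguments nface : simpl never.
Arguments ndegen : simpl never.
Arguments nervenat : simpl never.

Section Diagonal.
Variables (V : cartcat) (T : spfun V).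

Definition nervediag_face (m i : nat) :
  pnat (nervepfun (T m.+1) m.+1) (nervepfun (T m) m).
Proof.
exists (fun X (p : nerve (T m.+1) X m.+1) => nface i (nervenat (dface T i) p)).
move=> X Y F p; exact: etrans (congr1 (nface i) (nervemap_nat (dface T i) F p))
  (nervemap_face F i _).
Defined.

Definition nervediag_degen (m i : nat) :
  pnat (nervepfun (T m) m) (nervepfun (T m.+1) m.+1).
Proof.
exists (fun X (p : nerve (T m) X m) => ndegen i (nervenat (ddegen T i) p)).
move=> X Y F p; exact: etrans (congr1 (ndegen i) (nervemap_nat (ddegen T i) F p))
  (nervemap_degen F i _).
Defined.

Definition pnat_comp (T1 T2 T3 : pfun V) (psi : pnat T2 T3) (phi : pnat T1 T2) :
  pnat T1 T3.
Proof.
exists (fun a s => papp psi (papp phi s)).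
by move=> a b f s; rewrite !pappM.
Defined.

Lemma nervenat_swap (T1 T2 T2' T3 : pfun V) (phi : pnat T1 T2)
    (psi : pnat T2 T3) (phi' : pnat T1 T2') (psi' : pnat T2' T3)
    (X : ecat V) m (p : nerve T1 X m) :
  (forall a (s : T1 a), papp psi (papp phi s) = papp psi' (papp phi' s)) ->
  nervenat psi (nervenat phi p) = nervenat psi' (nervenat phi' p).
Proof.
move=> e; rewrite (nervenat_comp (chi := pnat_comp psi phi)) //.
by rewrite [RHS](nervenat_comp (chi := pnat_comp psi phi)) // => a s; rewrite -e.
Qed.

(** Faces of the diagonal are a face of the coefficients followed by a face of
    the nerve; the two kinds commute, so the identities are checked separately
    in each direction. *)
Definition nervediag : spfun (enriched V).
Proof.
exists (fun m => nervepfun (T m) m) nervediag_face nervediag_degen.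
- move=> m i j X p ij /=; rewrite -!nervenat_face nface_nface //.
  by congr (nface _ (nface _ _)); apply: nervenat_swap => a s; apply: dfaceK.
- move=> m i j X p ij /=; rewrite -nervenat_degen nface_ndegen_id //.
  rewrite (nervenat_comp (chi := pnat_comp (dface T i) (ddegen T j))) //.
  by apply: nervenat_id => a s; apply: ddegenK.
- move=> m i j X p ij /=; rewrite -nervenat_degen -nervenat_face nface_ndegen_lt //.
  by congr (ndegen _ (nface _ _)); apply: nervenat_swap => a s; apply: ddegen_lt.
- move=> m i j X p ij /=; rewrite -nervenat_degen -nervenat_face nface_ndegen_gt //.
  by congr (ndegen _ (nface _ _)); apply: nervenat_swap => a s; apply: ddegen_gt.
Defined.

End Diagonal.

Definition set_pfun : pfun set_cat.
Proof.
refine (@PFun set_cat (fun S => S) (fun _ _ f s => f s) _ _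
  (fun _ _ s t => (s, t)) _ _ _ tt _) => //.
- by move=> a b [].
- by case.
Defined.

Definition set_spfun : spfun set_cat.
Proof.
pose c : pnat set_pfun set_pfun :=
  @PNat _ set_pfun set_pfun (fun _ s => s) (fun _ _ _ _ => erefl).
by refine (@SPFun set_cat (fun=> set_pfun) (fun _ _ => c) (fun _ _ => c) _ _ _ _).
Defined.

(** Sets enter as discrete simplicial coefficients, so that the base case is a
    diagonal as well. *)
Fixpoint multinerve (n : nat) : spfun (nCat n.+1) :=
  if n is m.+1 then nervediag (multinerve m) else nervediag set_spfun.

(** * Magnitude nerves are free on multinerves *)

Lemma additive_intE (A : zmodType) (f : {additive int -> A}) (n : int) :
  f n = (f 1 *~ n)%R.
Proof. by rewrite -raddfMz -mulrzr mul1r intz. Qed.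

(** The abelian-group-valued coefficient system [S] is the free abelian group on
    [T], structure maps included. Freeness is split into a retraction [bdec]
    and the extensionality principle [bext]: this form passes through tensor
    products and direct sums with no explicit basis of either. *)
Record basis (V : cartcat) (T : pfun V) (S : coef V) := Basis {
  bgen : forall a, T a -> S a;
  bmap : forall a b (f : hom a b) s, cmap S f (bgen s) = bgen (pmap T f s);
  bmu : forall a b s t,
    cmu S a b (tens (bgen s) (bgen t)) = bgen (pmu T s t);
  beps : forall t : T one, ceps S (bgen t) = 1%R;
  bdec : forall a, {additive S a -> free_ab (T a)};
  bdecK : forall a (s : T a), bdec a (bgen s) = free_gen s;
  bext : forall a (A : zmodType) (u v : {additive S a -> A}),
    (forall s, u (bgen s) = v (bgen s)) -> u =1 v
}.
Arguments bgen {V T S} _ {a} _.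
Arguments bdec {V T S} _ a.
Arguments bext {V T S} _ {a A u v} _ _.

Lemma basis_bij (V : cartcat) (T : pfun V) (S : coef V) (B : basis T S) a :
  bijective (free_lift (fun s : T a => bgen B s)).
Proof.
exists (bdec B a).
- apply: (@presented_ext _ _ _ (acomp (bdec B a) (free_lift _)) (aid _)) => s.
  by rewrite acompE [X in bdec B a X]presented_liftE bdecK.
- apply: (bext B (u := acomp (free_lift _) (bdec B a)) (v := aid _)) => s.
  by rewrite acompE bdecK [LHS]presented_liftE.
Qed.

Section NerveBasis.
Variables (V : cartcat) (T : pfun V) (S : coef V) (B : basis T S).

Lemma chain_drop_gen (X : ecat V) (x y : X) (f : T (ehom x y)) :
  chain_drop S x y (bgen B f) = 1%R.
Proof. by rewrite /chain_drop acompE bmap beps. Qed.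

Lemma chain_cmp_gen (X : ecat V) (x y z : X)
    (f : T (ehom x y)) (g : T (ehom y z)) :
  chain_cmp S x y z (tens (bgen B f) (bgen B g)) = bgen B (pcomp f g).
Proof. by rewrite /chain_cmp acompE bmu bmap. Qed.

Fixpoint vertices (X : ecat V) (m : nat) : forall x : X, path T m x -> tup X m :=
  match m return forall x : X, path T m x -> tup X m with
  | 0 => fun _ _ => tt
  | m'.+1 => fun x q => (tag q, vertices (tagged q).2)
  end.

Fixpoint path_gen (X : ecat V) (m : nat) :
    forall (x : X) (q : path T m x), @chain V S X m (x, vertices q) :=
  match m return
    forall (x : X) (q : path T m x), @chain V S X m (x, vertices q) with
  | 0 => fun _ _ => 1%R : int
  | m'.+1 => fun x q => tens (bgen B (tagged q).1) (path_gen (tagged q).2)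
  end.

Definition nerve_gen (X : ecat V) m (p : nerve T X m) : MBgroup S X m :=
  dsum_in (@chain V S X m) (tag p, vertices (tagged p)) (path_gen (tagged p)).

(** The vertices of the face of a string agree with the face of its vertices
    only propositionally, so chains over different tuples are compared inside a
    sigma type. The first vertex is kept fixed: the tensor factor added by
    [tcons] depends on it. *)
Definition tchain (X : ecat V) m (x : X) :=
  {t : tup X m & @chain V S X m (x, t)}.

Definition tcons (X : ecat V) m (x y : X) (s : S (ehom x y))
  (c : tchain m y) : tchain m.+1 x :=
  existT (fun t : tup X m.+1 => @chain V S X m.+1 (x, t))
    (y, tag c) (tens s (tagged c)).

Definition tpath (X : ecat V) m (x : X) (q : path T m x) : tchain m x :=
  existT (fun t : tup X m => @chain V S X m (x, t)) (vertices q) (path_gen q).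

Definition tchain_in (X : ecat V) m (x : X) (c : tchain m x) : MBgroup S X m :=
  dsum_in (@chain V S X m) (x, tag c) (tagged c).

(** The inner faces and the last face; face [0] moves the first vertex and is
    treated in [nerve_gen_face]. *)
Lemma path_gen_face (X : ecat V) m i (x : X) (q : path T m.+1 x) :
  existT (fun t : tup X m => @chain V S X m (x, t))
    (tup_del i (vertices q)) (@chain_face V S X m i.+1 _ (path_gen q)) =
  tpath (pface i q).
Proof.
elim: m i x q => [|m IH] i x [y [f q]].
  rewrite /tpath; case: i => [|i]; congr existT;
  by rewrite [LHS]tensor_unitlE chain_drop_gen.
case: i => [|i].
  case: q => z [g q]; rewrite /tpath; congr existT.
  rewrite [LHS]acompE [path_gen _]/= tensor_assocE [LHS]tensor_mapE.
  by rewrite chain_cmp_gen.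
rewrite -[RHS]/(tcons (bgen B f) (tpath (pface i q))) -IH /tcons; congr existT.
by rewrite [LHS]tensor_mapE.
Qed.

Lemma nerve_gen_face (X : ecat V) m i (p : nerve T X m.+1) :
  MBface S X m i (nerve_gen p) = nerve_gen (nface i p).
Proof.
case: p => x q; rewrite [LHS]dsum_mapE.
case: i => [|i]; last first.
  have e := congr1 (@tchain_in X m x) (path_gen_face i q).
  exact: e.
case: q => y [f q]; rewrite /nerve_gen /nface.
have -> : @chain_face V S X m 0 _ (path_gen (pcons f q)) = path_gen q.
  case: m q => [|m] q; rewrite [LHS]tensor_unitlE chain_drop_gen mulr1z //.
by case: m q.
Qed.

Lemma nerve_gen_map (X Y : ecat V) (F : efun X Y) m (p : nerve T X m) :
  dsum_map (chain_map S F (m := m)) (nerve_gen p) = nerve_gen (nervemap F p).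
Proof.
case: p => x q; rewrite [LHS]dsum_mapE.
suff e : existT (fun t : tup Y m => @chain V S Y m (F x, t))
    (tup_map F (vertices q)) (@chain_map V S X Y F m (x, vertices q) (path_gen q)) =
    tpath (pathmap F q).
  have := congr1 (@tchain_in Y m (F x)) e; exact.
elim: m x q => [|m IH] x q; first by rewrite /tpath.
case: q => y [f q].
rewrite -[RHS]/(tcons _ (tpath (pathmap F q))) -IH /tcons; congr existT.
by rewrite [LHS]tensor_mapE bmap.
Qed.

Lemma chain_zip_tens (X Y : ecat V) m (p : tup X m.+2) (q : tup Y m.+2)
    (s : S (ehom p.1 p.2.1)) (c : @chain V S X m p.2)
    (t : S (ehom q.1 q.2.1)) (d : @chain V S Y m q.2) :
  @chain_zip V S X Y m.+1 p q (tens (tens s c) (tens t d)) =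
  tens (cmu S _ _ (tens s t)) (@chain_zip V S X Y m p.2 q.2 (tens c d)).
Proof.
pose u := tensor_map (cmu S (ehom p.1 p.2.1) (ehom q.1 q.2.1))
                        (@chain_zip V S X Y m p.2 q.2).
have e1 := congr1 u (tensor_swapE s t c d).
have e2 := tensor_mapE (cmu S (ehom p.1 p.2.1) (ehom q.1 q.2.1))
                        (@chain_zip V S X Y m p.2 q.2) (tens s t) (tens c d).
exact (etrans e1 e2).
Qed.

Lemma path_gen_zip (X Y : ecat V) m (x : X) (p : path T m x) (y : Y)
    (q : path T m y) :
  existT (fun t : tup (ecat_prd X Y) m => @chain V S (ecat_prd X Y) m ((x, y), t))
    (tup_zip (vertices p) (vertices q))
    (@chain_zip V S X Y m (x, vertices p) (y, vertices q)
       (tens (path_gen p) (path_gen q))) =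
  @tpath (ecat_prd X Y) m (x, y) (pathzip p q).
Proof.
elim: m x p y q => [|m IH] x p y q.
  have e : @chain_zip V S X Y 0 (x, tt) (y, tt) (tens (1%R : int) (1%R : int)) = 1%R.
    exact: tensor_unitlE.
  exact (congr1 (existT (fun t : unit =>
    @chain V S (ecat_prd X Y) 0 ((x, y), t)) tt) e).
case: p => x' [f p]; case: q => y' [g q].
pose cons := @tcons (ecat_prd X Y) m (x, y) (x', y').
have E1 := chain_zip_tens (p := (x, (x', vertices p))) (q := (y, (y', vertices q)))
  (bgen B f) (path_gen p) (bgen B g) (path_gen q).
rewrite bmu in E1.
have E2 := congr1 (cons (bgen B (pmu T f g))) (IH x' p y' q).
exact (etrans (congr1 (existT (fun t : tup (ecat_prd X Y) m.+1 =>
      @chain V S (ecat_prd X Y) m.+1 ((x, y), t))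
    ((x', y'), tup_zip (vertices p) (vertices q))) E1) E2).
Qed.

Lemma nerve_gen_zip (X Y : ecat V) m (p : nerve T X m) (q : nerve T Y m) :
  cmu (MBcoef S m) X Y (tens (nerve_gen p) (nerve_gen q)) =
  nerve_gen (nervezip p q).
Proof.
case: p => x p; case: q => y q.
have e := dsum_tensorE (C := @chain V S (ecat_prd X Y) m) (u := @tup_zip X Y m.+1)
  (@chain_zip V S X Y m) (path_gen p) (path_gen q).
exact (etrans e (congr1 (@tchain_in (ecat_prd X Y) m (x, y)) (path_gen_zip p q))).
Qed.

Lemma nerve_gen_eps m (p : nerve T (ecat_one V) m) :
  dsum_lift (@chain_eps V S m) (nerve_gen p) = 1%R.
Proof.
case: p => x q; rewrite [LHS]dsum_liftE.
elim: m x q => [|m IH] x q //; case: q => y [f q].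
by rewrite [LHS]acompE tensor_unitlE beps mulr1z [LHS]IH.
Qed.

Fixpoint chain_dec (X : ecat V) (m : nat) :
    forall p : tup X m.+1, {additive @chain V S X m p -> free_ab (path T m p.1)} :=
  match m return
    forall p : tup X m.+1, {additive @chain V S X m p -> free_ab (path T m p.1)} with
  | 0 => fun p => int_scale (free_gen tt)
  | m'.+1 => fun p =>
      acomp (free_lift (fun fq : T (ehom p.1 p.2.1) * path T m' p.2.1 =>
               free_gen (pcons fq.1 fq.2)))
        (acomp (free_mu _ _)
          (tensor_map (bdec B (ehom p.1 p.2.1)) (@chain_dec X m' p.2)))
  end.

Lemma chain_dec_gen (X : ecat V) m (x : X) (q : path T m x) :
  @chain_dec X m (x, vertices q) (path_gen q) = free_gen q.
Proof.
elim: m x q => [|m IH] x q; first by case: q; apply: mulr1z.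
case: q => y [f q]; rewrite [LHS]acompE acompE [path_gen _]/= tensor_mapE.
by rewrite bdecK IH free_muE [LHS]presented_liftE.
Qed.

(** Chains over all tuples with first vertex [x] are generated by strings. The
    quantification over a whole family [k] makes the induction go through: after
    the first tensor factor has been reduced to a generator, the rest is again
    such a family, one vertex further. *)
Lemma chain_expand (X : ecat V) m (x : X) (A : zmodType)
    (k : forall t : tup X m, {additive @chain V S X m (x, t) -> A}) t c :
  k t c =
  free_lift (fun q : path T m x => k _ (path_gen q)) (@chain_dec X m (x, t) c).
Proof.
elim: m x A k t c => [|m IH] x A k t c.
  case: t c => c; rewrite (additive_intE (k tt)).
  rewrite [X in _ = free_lift _ X]/= [RHS]raddfMz; congr (_ *~ _)%R.
  by rewrite [RHS]presented_liftE.
case: t c => y t c.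
pose R : {additive free_ab (path T m.+1 x) -> A} :=
  free_lift (fun q : path T m.+1 x => k _ (path_gen q)).
apply: (tensor_ext (f := k (y, t)) (g := acomp R (@chain_dec X m.+1 (x, (y, t))))).
move=> s d; rewrite acompE.
pose u := acomp (k (y, t))
  (additive_of (@tensDl (S (ehom x y)) (@chain V S X m (y, t)) d)).
pose v := acomp (acomp R (@chain_dec X m.+1 (x, (y, t))))
  (additive_of (@tensDl _ _ d)).
rewrite -[LHS]/(u s) -[RHS]/(v s); apply: (bext B) => {}s.
rewrite -[LHS]/(acomp (k (y, t)) (tens_with _ (bgen B s)) d).
rewrite (IH y A (fun t => acomp (k (y, t)) (tens_with _ (bgen B s)))).
have e : @chain_dec X m.+1 (x, (y, t)) (tens (bgen B s) d) =
    free_lift (fun fq => free_gen (pcons fq.1 fq.2))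
      (free_mu _ _ (tens (free_gen s) (@chain_dec X m (y, t) d))).
  by rewrite -(bdecK B); congr (free_lift _ (free_mu _ _ _)); apply: tensor_mapE.
rewrite -[RHS]/(R (@chain_dec X m.+1 (x, (y, t)) (tens (bgen B s) d))) e.
move: (@chain_dec X m (y, t) d) => z.
pose h : {additive free_ab (T (ehom x y) * path T m y) -> free_ab (path T m.+1 x)} :=
  free_lift (fun fq => free_gen (pcons fq.1 fq.2)).
apply: (@presented_ext _ _ _ (free_lift _)
  (acomp R (acomp h (acomp (free_mu _ _) (tens_with _ (free_gen s)))))) => q.
have e2 : h (free_mu _ _ (tens (free_gen s) (free_gen q))) = free_gen (pcons s q).
  by rewrite free_muE; apply: presented_liftE.
rewrite [LHS]presented_liftE.
rewrite -[RHS]/(R (h (free_mu _ _ (tens (free_gen s) (free_gen q))))).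
by rewrite e2 [RHS]presented_liftE.
Qed.

Lemma nerve_gen_ext (X : ecat V) m (A : zmodType)
    (u v : {additive MBgroup S X m -> A}) :
  (forall p : nerve T X m, u (nerve_gen p) = v (nerve_gen p)) -> u =1 v.
Proof.
move=> uv; apply: dsum_ext => -[x t] c.
pose k (w : {additive MBgroup S X m -> A}) (t : tup X m) :=
  acomp w (dsum_in (@chain V S X m) (x, t)).
have e : (fun q : path T m x => k u _ (path_gen q)) = fun q => k v _ (path_gen q).
  by apply/funext => q; apply: (uv (existT _ x q)).
have := chain_expand (k u) c; rewrite e => eu.
exact: etrans eu (esym (chain_expand (k v) c)).
Qed.

Definition nerve_dec (X : ecat V) m :
    {additive MBgroup S X m -> free_ab (nerve T X m)} :=
  dsum_lift (fun p : tup X m.+1 =>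
    acomp (free_lift (fun q : path T m p.1 =>
             free_gen (existT _ p.1 q : nerve T X m)))
          (@chain_dec X m p)).

Lemma nerve_decK (X : ecat V) m (p : nerve T X m) :
  nerve_dec X m (nerve_gen p) = free_gen p.
Proof.
case: p => x q; rewrite [LHS]dsum_liftE acompE chain_dec_gen.
exact: presented_liftE.
Qed.

Definition nerve_basis m : basis (nervepfun T m) (MBcoef S m) :=
  @Basis (enriched V) (nervepfun T m) (MBcoef S m)
    (fun X => @nerve_gen X m)
    (fun X Y F => @nerve_gen_map X Y F m)
    (fun X Y => @nerve_gen_zip X Y m)
    (@nerve_gen_eps m)
    (fun X => nerve_dec X m)
    (fun X => @nerve_decK X m)
    (fun X => @nerve_gen_ext X m).

End NerveBasis.

(** Used for the faces of the bisimplicial group in the coefficient direction. *)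
Lemma nerve_gen_nat (V : cartcat) (T T' : pfun V) (S S' : coef V)
    (B : basis T S) (B' : basis T' S') (psi : pnat T T')
    (phi : forall a, {additive S a -> S' a})
    (phi_gen : forall a (s : T a), phi a (bgen B s) = bgen B' (papp psi s))
    (X : ecat V) m (p : nerve T X m) :
  MBnat phi X m (nerve_gen B p) = nerve_gen B' (nervenat psi p).
Proof.
case: p => x q; rewrite [LHS]dsum_mapE.
suff e : existT (fun t : tup X m => @chain V S' X m (x, t))
    (vertices q) (@chain_nat V S S' phi X m (x, vertices q) (path_gen B q)) =
    tpath B' (pathnat psi q).
  have := congr1 (@tchain_in V S' X m x) e; exact.
elim: m x q => [|m IH] x q; first by rewrite /tpath.
case: q => y [f q].
rewrite -[RHS]/(tcons (bgen B' (papp psi f)) (tpath B' (pathnat psi q))) -IH /tcons.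
by congr existT; rewrite [LHS]tensor_mapE phi_gen.
Qed.

Record sbasis (V : cartcat) (T : spfun V) (S : scoef V) := SBasis {
  slevb :> forall m, basis (T m) (S m);
  sface_gen : forall m (i : 'I_m.+2) a (s : T m.+1 a),
    sface S i a (bgen (slevb m.+1) s) = bgen (slevb m) (papp (dface T i) s)
}.

Definition diag_sbasis (V : cartcat) (T : spfun V) (S : scoef V)
  (B : sbasis T S) : sbasis (nervediag T) (MBdiag S).
Proof.
exists (fun m => nerve_basis (B m) m) => m i X p.
rewrite [LHS]acompE (nerve_gen_nat (psi := dface T i) (B' := B m)).
  exact: nerve_gen_face.
by move=> a s; apply: sface_gen.
Defined.

Definition set_basis : basis set_pfun free_coef.
Proof.
refine (@Basis set_cat set_pfun free_coef (fun S s => free_gen s) _ _ _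
  (fun S => aid _) _ _).
- by move=> S S' f s; apply: presented_liftE.
- by move=> S S' s t; apply: free_muE.
- by move=> t; apply: presented_liftE.
- by [].
- by move=> S A u v; apply: presented_ext.
Defined.

Definition multinerve_basis n : sbasis (multinerve n) (MB n).
Proof.
elim: n => [|n IH]; last exact: diag_sbasis IH.
exists (fun m => nerve_basis set_basis m) => m i X p.
have e : nervenat (dface set_spfun (m := m) i : pnat set_pfun set_pfun) p = p.
  exact (@nervenat_id set_cat set_pfun (dface set_spfun (m := m) i) X m.+1 p
    (fun a s => erefl)).
exact: etrans (nerve_gen_face set_basis i p)
  (congr1 (fun r => nerve_gen set_basis (nface i r)) (esym e)).
Defined.

(** * The nerve of a suspension *)

Section SuspensionNerve.
Variables (V : cartcat) (X : ecat V).

Section Paths.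
Variable T : pfun (enriched V).

(** The unique element of [T] of an endomorphism object of [susp X]. *)
Definition suspension_unit (x : susp_ob) : T (ehom (x : susp X) x) :=
  match x with suspA | suspB => punit T end.

Fixpoint pathB (l : nat) : path T l (suspB : susp X) :=
  if l is l'.+1 then pcons (suspension_unit suspB) (pathB l') else tt.

Fixpoint pathA (y : T X) (l i : nat) : path T l (suspA : susp X) :=
  match l, i with
  | 0, _ => tt
  | l'.+1, 0 => pcons (X := susp X) (x := suspA) (y := suspB) y (pathB l')
  | l'.+1, i'.+1 => pcons (suspension_unit suspA) (pathA y l' i')
  end.

(** The simplex with vertices [i] times [A] and then [B], whose only arrow from
    [A] to [B], if there is one, is [y]; for [i > l] all vertices are [A]. The
    end cases ignore [y], which gives all faces the same formula. *)
Definition susp_simplex (l i : nat) (y : T X) : nerve T (susp X) l :=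
  if i is i'.+1 then existT _ (suspA : susp X) (pathA y l i')
  else existT _ (suspB : susp X) (pathB l).

Lemma pcomp_unitB (y : T X) :
  pcomp (X := susp X) (x := suspA) (y := suspB) (z := suspB)
    (y : T (ehom (suspA : susp X) suspB)) (suspension_unit suspB) = y.
Proof. exact: pmu1. Qed.

Lemma pcomp_unitA (y : T X) :
  pcomp (X := susp X) (x := suspA) (y := suspA) (z := suspB)
    (suspension_unit suspA) (y : T (ehom (suspA : susp X) suspB)) = y.
Proof. exact: pmu2. Qed.

Lemma pcomp_units (x : susp_ob) :
  pcomp (X := susp X) (x := x) (y := x) (z := x)
    (suspension_unit x) (suspension_unit x) = suspension_unit x.
Proof. by case: x; apply: punitP. Qed.

Lemma suspension_unitP (x : susp_ob) (f : T (ehom (x : susp X) x)) :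
  f = suspension_unit x.
Proof. by case: x f => f; apply: punitP. Qed.

Let consB l := @pcons _ T (susp X) l suspB suspB (suspension_unit suspB).
Let consA l := @pcons _ T (susp X) l suspA suspA (suspension_unit suspA).
Let consAB l y := @pcons _ T (susp X) l suspA suspB y.

Lemma pface_pathB l j : pface j (pathB l.+1) = pathB l.
Proof.
elim: l j => [|l IH] [|j] //; last exact (congr1 (@consB l) (IH j)).
exact (congr1 (fun f => @pcons _ T (susp X) l suspB suspB f (pathB l))
  (pcomp_units suspB)).
Qed.

Lemma pface_pathA y l i j : pface j (pathA y l.+1 i) = pathA y l (i - (j < i)).
Proof.
elim: l i j => [|l IH] i j; first exact: path0.
case: j => [|j].
  case: i => [|[|i]].
  - exact (congr1 (fun f => consAB f (pathB l)) (pcomp_unitB y)).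
  - exact (congr1 (fun f => consAB f (pathB l)) (pcomp_unitA y)).
  - exact (congr1 (fun f => @pcons _ T (susp X) l suspA suspA f (pathA y l i))
      (pcomp_units suspA)).
case: i => [|i]; first exact (congr1 (@consAB l y) (pface_pathB l j)).
refine (etrans (congr1 (@consA l) (IH i j)) _).
by rewrite ltnS subSn //; case: ltnP => //; apply: leq_trans.
Qed.

(** Dropping one of the [i] copies of [A] lowers [i], dropping a [B] does not:
    the index behaves as a simplex of the interval. *)
Lemma nface_susp l i j (y : T X) :
  nface j (susp_simplex l.+1 i y) = susp_simplex l (i - (j < i)) y.
Proof.
case: j => [|j].
  by case: i => [|[|i]].
case: i => [|i].
  exact (congr1 (existT _ (suspB : susp X)) (pface_pathB l j)).
apply: etrans (congr1 (existT _ (suspA : susp X)) (pface_pathA y l i j)) _.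
by rewrite ltnS subSn //; case: ltnP => //; apply: leq_trans.
Qed.

(** No arrow goes from [B] to [A], so every simplex arises from
    [susp_simplex]; the value [y0] is returned when there is no arrow from [A]
    to [B]. *)
Section Decoding.
Variables (no_map : T (ecat_zero V) -> False) (y0 : T X).

Fixpoint decA (l : nat) : path T l (suspA : susp X) -> nat * T X :=
  match l return path T l (suspA : susp X) -> nat * T X with
  | 0 => fun _ => (1, y0)
  | l'.+1 => fun p =>
      match tag p as z
        return T (ehom (suspA : susp X) z) * path (X := susp X) T l' z ->
          nat * T X with
      | suspA => fun fq => ((decA fq.2).1.+1, (decA fq.2).2)
      | suspB => fun fq => (1, fq.1 : T X)
      end (tagged p)
  end.

Definition susp_dec (l : nat) (u : nerve T (susp X) l) : nat * T X :=
  match tag u as x return path (X := susp X) T l x -> nat * T X with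
  | suspA => @decA l
  | suspB => fun _ => (0, y0)
  end (tagged u).

Lemma decA_pathA l i y :
  decA (pathA y l i) = if i < l then (i.+1, y) else (l.+1, y0).
Proof.
by elim: l i => [|l IH] [|i] //=; rewrite IH ltnS; case: ifP.
Qed.

Lemma susp_decE l i y : i <= l.+1 ->
  susp_dec (susp_simplex l i y) = (i, if 0 < i <= l then y else y0).
Proof.
case: i => [|i] // il; rewrite [LHS]decA_pathA.
by case: ltnP => //= li; congr (_, _); apply/eqP; rewrite eqSS eqn_leq li.
Qed.

Lemma susp_dec_le l u : (@susp_dec l u).1 <= l.+1.
Proof.
case: u => -[] p //.
rewrite /susp_dec /=; elim: l p => [|l IH] // [[] [f q]] //=.
exact: IH.
Qed.

Lemma pathB_uniq l (q : path T l (suspB : susp X)) : q = pathB l.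
Proof.
elim: l q => [|l IH] q; first exact: path0.
case: q => -[] [f q]; first by case: (no_map f).
by rewrite (IH q) [f]suspension_unitP.
Qed.

Lemma susp_decK l (u : nerve T (susp X) l) :
  susp_simplex l (susp_dec u).1 (susp_dec u).2 = u.
Proof.
case: u => -[] p; last by rewrite [p]pathB_uniq.
rewrite /susp_dec /=.
suff [i [-> e]] : exists i, (decA p).1 = i.+1 /\ pathA (decA p).2 l i = p.
  by rewrite -[in RHS]e.
elim: l p => [|l IH] p; first by exists 0; split => //; apply: path0.
case: p => -[] [f q].
  have [i [e1 e2]] := IH q; exists i.+1; split; first by rewrite /= e1.
  by rewrite [f]suspension_unitP -[in RHS]e2.
by exists 0; rewrite [q]pathB_uniq.
Qed.

End Decoding.
End Paths.

Lemma nervenat_susp (T T' : pfun (enriched V)) (phi : pnat T T') l i (y : T X) :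
  nervenat phi (susp_simplex l i y) = susp_simplex l i (papp phi y).
Proof.
have eU x : papp phi (suspension_unit T x) = suspension_unit T' x.
  exact: suspension_unitP.
have eB k : pathnat phi (pathB T k) = pathB T' k.
  by elim: k => [|k IH] //=; rewrite IH [papp _ _](eU suspB).
case: i => [|i]; first exact (congr1 (existT _ (suspB : susp X)) (eB l)).
apply: (congr1 (existT _ (suspA : susp X))).
elim: l i => [|l IH] [|i] //=; rewrite ?eB // IH.
by rewrite [papp _ (suspension_unit T suspA)](eU suspA).
Qed.

End SuspensionNerve.

(** * Isomorphisms and homology classes *)

Section AdditiveIsomorphisms.
Local Open Scope ring_scope.

Lemma zmod_iso_of (A B : zmodType) (f : {additive A -> B}) :
  (forall x, f x = 0 -> x = 0) -> (forall y, exists x, f x = y) -> zmod_iso A B.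
Proof.
move=> f_inj f_surj; exists f.
have [g gK] := choice f_surj.
exists g => // x; apply/subr0_eq/f_inj.
by rewrite raddfB gK subrr.
Qed.

Lemma zmod_iso_trans (A B C : zmodType) :
  zmod_iso A B -> zmod_iso B C -> zmod_iso A C.
Proof. by move=> [f fb] [g gb]; exists (acomp g f); apply: bij_comp. Qed.

Lemma zmod_iso_sym (A B : zmodType) : zmod_iso A B -> zmod_iso B A.
Proof.
move=> [f [g fK gK]].
have gD : {morph g : x y / x + y}.
  by move=> x y; rewrite -{1}[x]gK -{1}[y]gK -raddfD fK.
by exists (additive_of gD), f.
Qed.

Lemma zmod_iso_prod (A B C : zmodType) :
  zmod_iso A B -> zmod_iso (A * C)%type (B * C)%type.
Proof.
move=> [f [g fK gK]].
have hD : {morph (fun p : A * C => (f p.1, p.2)) : p q / p + q}.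
  by move=> p q; rewrite /= raddfD.
exists (additive_of hD); exists (fun p => (g p.1, p.2)).
  by case=> a c /=; rewrite fK.
by case=> b c /=; rewrite gK.
Qed.

End AdditiveIsomorphisms.

Section HomologyClasses.
Variables (A : nat -> zmodType)
  (face : forall m, 'I_m.+2 -> {additive A m.+1 -> A m}).
Local Open Scope ring_scope.
Local Open Scope quotient_scope.

Definition hclass k (c : cycle face k) : homology face k := \pi c.

Fact hclassD k : {morph @hclass k : x y / x + y}.
Proof. by move=> x y; rewrite /hclass Quotient.pi_add. Qed.

HB.instance Definition _ k := GRing.isZmodMorphism.Build _ _ (@hclass k)
  (raddfB (additive_of (@hclassD k))).

Lemma hclass_surj k (h : homology face k) : exists c, h = hclass c.
Proof. by exists (repr h); rewrite /hclass reprK. Qed.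

Lemma hclass_eq0 k (c : cycle face k) :
  hclass c = 0 <-> exists y, val c = diff face y.
Proof.
rewrite -[0](raddf0 (hclass (k := k))); split=> [/eqP|[y e]].
  by rewrite -Quotient.idealrBE subr0 unfold_in => /asboolP.
apply/eqP; rewrite -Quotient.idealrBE subr0 unfold_in; apply/asboolP.
by exists y.
Qed.

Section Lift.
Variables (k : nat) (M : zmodType) (g : {additive cycle face k -> M}).
Hypothesis g_bnd : forall c y, val c = diff face y -> g c = 0.

Lemma hlift_repr c : g (repr (hclass c)) = g c.
Proof.
apply/subr0_eq; rewrite -raddfB.
have /hclass_eq0[y] : hclass (repr (hclass c) - c) = 0.
  by rewrite raddfB [X in X - _]reprK subrr.
exact: g_bnd.
Qed.

Fact hliftD : {morph (fun h : homology face k => g (repr h)) : x y / x + y}.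
Proof.
move=> x y; have [[c ->] [d ->]] := (hclass_surj x, hclass_surj y).
by rewrite -(raddfD (hclass (k := k))) !hlift_repr raddfD.
Qed.

Definition hlift : {additive homology face k -> M} := additive_of hliftD.

Lemma hliftE c : hlift (hclass c) = g c.
Proof. exact: hlift_repr. Qed.

End Lift.

End HomologyClasses.

Section ChainMap.
Local Open Scope ring_scope.
Variables (A B : nat -> zmodType)
  (fA : forall m, 'I_m.+2 -> {additive A m.+1 -> A m})
  (fB : forall m, 'I_m.+2 -> {additive B m.+1 -> B m}).

(** The two degrees may differ, so that maps lowering the degree are covered. *)
Section Degree.
Variables (k l : nat) (g : {additive A k -> B l}).
Hypothesis g_cycle : forall c, is_cycle fA c -> is_cycle fB (g c).
Hypothesis g_bnd : forall y, exists z, g (diff fA y) = diff fB z.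

Definition cycle_fun (c : cycle fA k) : cycle fB l :=
  @Cycle _ fB l (g (val c)) (g_cycle (valP c)).

Fact cycle_funD : {morph (fun c => hclass (cycle_fun c)) : x y / x + y}.
Proof.
by move=> x y; rewrite -raddfD; congr hclass; apply: val_inj; rewrite /= raddfD.
Qed.

Fact cycle_fun_bnd c y : val c = diff fA y -> additive_of cycle_funD c = 0.
Proof.
move=> e; apply/hclass_eq0; have [z ez] := g_bnd y.
by exists z; rewrite /= e.
Qed.

Definition homology_map : {additive homology fA k -> homology fB l} :=
  hlift cycle_fun_bnd.

Lemma homology_mapE c : homology_map (hclass c) = hclass (cycle_fun c).
Proof. exact: hliftE. Qed.

Lemma homology_map_inj :
  (forall c z, is_cycle fA c -> g c = diff fB z -> exists y, c = diff fA y) ->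
  forall h, homology_map h = 0 -> h = 0.
Proof.
move=> inj h; have [c ->] := hclass_surj h.
rewrite homology_mapE => /hclass_eq0[z e]; apply/hclass_eq0.
exact: inj (valP c) e.
Qed.

End Degree.

Lemma homology_transfer (g : forall m, {additive A m -> B m}) k :
  (forall m, bijective (g m)) ->
  (forall m (i : 'I_m.+2) x, g m (fA i x) = fB i (g m.+1 x)) ->
  zmod_iso (homology fA k) (homology fB k).
Proof.
move=> gb gf.
have gd m x : g m (diff fA x) = diff fB (g m.+1 x).
  by rewrite raddf_sum; apply: eq_bigr => i _; rewrite raddfMz gf.
have gI m := bij_inj (gb m).
have g_cyc j c : is_cycle fA c = is_cycle fB (g j c).
  case: j c => [//|j] c /=; rewrite -gd.
  by apply/eqP/eqP => [->|e]; [rewrite raddf0 | apply: (gI j); rewrite e raddf0].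
have g_cyc' j c : is_cycle fA c -> is_cycle fB (g j c) by rewrite g_cyc.
have g_bnd j y : exists z, g j (diff fA y) = diff fB z by exists (g j.+1 y).
apply: (zmod_iso_of (f := homology_map (@g_cyc' k) (@g_bnd k))).
  apply: homology_map_inj => c z _ e.
  have [g' gK g'K] := gb k.+1; exists (g' z); apply: (gI k).
  by rewrite gd g'K.
move=> h; have [c ->] := hclass_surj h; have [g' gK g'K] := gb k.
have cyc : is_cycle fA (g' (val c)) by rewrite g_cyc g'K; apply: valP.
exists (hclass (Cycle cyc)); rewrite homology_mapE; congr hclass.
by apply: val_inj; rewrite /= g'K.
Qed.

End ChainMap.

(** * Alternating sums *)

Section AlternatingSums.
Local Open Scope ring_scope.
Variable A : zmodType.
Implicit Types (x : A) (F G : nat -> nat -> A).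

Lemma mulrz_signS x k : x *~ (-1) ^+ k.+1 = - (x *~ (-1) ^+ k).
Proof. by rewrite exprS mulN1r mulrNz. Qed.

Lemma mulrz_signK x k : x *~ (-1) ^+ k *~ (-1) ^+ k = x.
Proof. by rewrite -mulrzA -exprMn mulrNN mulr1 expr1n. Qed.

Lemma sum_sign n : \sum_(k < n) (-1) ^+ k = (odd n)%:R :> int.
Proof.
elim: n => [|n IH]; first by rewrite big_ord0.
by rewrite big_ord_recr /= IH -signr_odd; case: odd.
Qed.

(** A simplicial homotopy gives a chain homotopy: off the two diagonals [k = j]
    and [k = j.+1] the terms of [F] cancel against those of [G], and the
    diagonals telescope. *)
Lemma simplicial_homotopy_sum F G m :
  (forall k j, (k < j <= m)%N -> F k j = G k j.-1) ->
  (forall k j, (j.+1 < k <= m.+1)%N -> F k j = G k.-1 j) ->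
  (forall j, (j < m)%N -> F j.+1 j = F j.+1 j.+1) ->
  \sum_(k < m.+2) (\sum_(j < m.+1) F k j *~ (-1) ^+ j) *~ (-1) ^+ k +
  \sum_(k < m.+1) (\sum_(j < m) G k j *~ (-1) ^+ j) *~ (-1) ^+ k =
  F 0%N 0%N - F m.+1 m.
Proof.
move=> F_lt F_gt F_mid.
pose sg H k j : A := H k j *~ (-1) ^+ j *~ (-1) ^+ k.
have sgE (H : nat -> nat -> A) a b :
    \sum_(k < a) (\sum_(j < b) H k j *~ (-1) ^+ j) *~ (-1) ^+ k =
    \sum_(j < b) \sum_(k < a) sg H k j.
  rewrite exchange_big; apply: eq_bigr => k _; exact: mulrz_suml.
rewrite !sgE {sgE}.
have diag (j : 'I_m.+1) : \sum_(k < m.+2)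
    ((if k == j :> nat then sg F k j else 0) +
     (if k == j.+1 :> nat then sg F k j else 0)) = F j j - F j.+1 j.
  rewrite big_split /= -!big_mkcond /=.
  rewrite (big_pred1 (widen_ord (leqnSn _) j)) //.
  rewrite (big_pred1 (lift ord0 j)); last by move=> k; rewrite /= -val_eqE.
  by rewrite /sg /= mulrz_signS !mulrz_signK.
have split_j (j : 'I_m.+1) : \sum_(k < m.+2) sg F k j =
    (\sum_(k < m.+2) (if (k < j)%N then sg F k j else 0) +
     \sum_(k < m.+2) (if (j.+1 < k)%N then sg F k j else 0)) +
    (F j j - F j.+1 j).
  rewrite -diag -!big_split; apply: eq_bigr => k _ /=.
  by case: ifP => h1; case: ifP => h2; case: ifP => h3; case: ifP => h4;
    rewrite ?addr0 ?add0r //; lia.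
have telescope p : (p <= m)%N ->
    \sum_(j < p.+1) (F j j - F j.+1 j) = F 0 0 - F p.+1 p.
  elim: p => [|p IH] pm; first by rewrite big_ord1.
  by rewrite big_ord_recr /= (IH (ltnW pm)) F_mid // addrA addrNK.
rewrite (eq_bigr _ (fun j _ => split_j j)) big_split /= telescope //.
rewrite addrAC -[RHS]add0r; congr (_ + _).
rewrite big_split /= big_ord_recl /= [X in X + _ + _ + _]big1 // add0r.
rewrite [X in _ + X + _]big_ord_recr /= [X in _ + (_ + X) + _]big1; last first.
  by move=> k _; have := ltn_ord k; case: ifP => //; lia.
rewrite addr0 -!big_split /= big1 // => j _.
rewrite [X in X + _ + _]big_ord_recr /= ifF ?addr0; last first.
  by have := ltn_ord j; rewrite /bump; lia.
rewrite [X in _ + X + _]big_ord_recl /= add0r -!big_split /= big1 // => k _.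
have [hj hk] := (ltn_ord j, ltn_ord k); rewrite /sg /bump /= !add1n !ltnS.
case: (leqP k j) => kj.
  by rewrite F_lt ?ltnS ?kj // mulrz_signS mulNrz addr0 addNr.
by rewrite F_gt ?ltnS ?kj // mulrz_signS add0r addNr.
Qed.

End AlternatingSums.

(** * The chain complex of a semi-simplicial set *)

Section FreeMaps.
Local Open Scope ring_scope.

Lemma free_ext (S : Type) (A : zmodType) (f g : {additive free_ab S -> A}) :
  (forall x, f (free_gen x) = g (free_gen x)) -> f =1 g.
Proof. exact: presented_ext. Qed.

Definition zscale (A : zmodType) (n : int) : {additive A -> A} :=
  additive_of (fun x y => @mulrzDl A n x y).

End FreeMaps.

Section FreeComplex.
Local Open Scope ring_scope.
Variables (Y : nat -> Type) (d : forall m, nat -> Y m.+1 -> Y m).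
Arguments d {m} _ _.

Definition fface m (i : 'I_m.+2) : {additive free_ab (Y m.+1) -> free_ab (Y m)} :=
  free_lift (fun y => free_gen (d i y)).

Definition fdiff m : {additive free_ab (Y m.+1) -> free_ab (Y m)} :=
  diff (A := fun m => free_ab (Y m)) fface (m := m).

Definition aug m : {additive free_ab (Y m) -> int} := free_lift (fun=> 1).

Lemma fdiff_gen m (y : Y m.+1) :
  fdiff m (free_gen y) = \sum_(i < m.+2) free_gen (d i y) *~ (-1) ^+ i.
Proof. by apply: eq_bigr => i _; rewrite [fface _ _]presented_liftE. Qed.

Lemma aug_gen m (y : Y m) : aug m (free_gen y) = 1.
Proof. exact: presented_liftE. Qed.

Lemma sum_const_sign (A : zmodType) (a : A) n :
  \sum_(i < n) a *~ (-1) ^+ i = a *~ (odd n)%:R.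
Proof. by rewrite -mulrz_sumr sum_sign. Qed.

Lemma aug_fdiff m x : aug m (fdiff m x) = aug m.+1 x * (odd m)%:R.
Proof.
pose f := acomp (aug m) (fdiff m).
pose g := acomp (int_scale ((odd m)%:R : int)) (aug m.+1).
suff -> : aug m (fdiff m x) = g x by rewrite acompE mulrC -mulrzz.
apply: (free_ext (f := f) (g := g)) => y.
rewrite !acompE [X in aug _ X]fdiff_gen raddf_sum [X in int_scale _ X]aug_gen.
rewrite (eq_bigr (fun i : 'I_m.+2 => 1 *~ (-1) ^+ i)); last first.
  by move=> i _; rewrite [LHS]raddfMz aug_gen.
by rewrite sum_const_sign /= negbK intz mulr1z.
Qed.

(** Such a family spans a copy of the chains of a point, which is acyclic in
    positive degrees. *)
Section ConstantSimplex.
Variables (p : forall m, Y m).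
Hypothesis dp : forall m i, (i <= m.+1)%N -> d i (p m.+1) = p m.

Lemma fdiff_const m : fdiff m (free_gen (p m.+1)) = free_gen (p m) *~ (odd m)%:R.
Proof.
rewrite fdiff_gen (eq_bigr (fun i : 'I_m.+2 => free_gen (p m) *~ (-1) ^+ i)).
  by rewrite sum_const_sign /= negbK.
by move=> i _; rewrite dp // -ltnS.
Qed.

Lemma const_bounds m (n : int) : n * (odd m)%:R = 0 ->
  exists w, free_gen (p m.+1) *~ n = fdiff m.+1 w.
Proof.
case e : (odd m) => /= n0.
  by exists 0; rewrite raddf0 -[n]mulr1 n0 mulr0z.
exists (free_gen (p m.+2) *~ n).
by rewrite raddfMz fdiff_const /= e mulr1z.
Qed.

End ConstantSimplex.

End FreeComplex.

Arguments fdiff : simpl never.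
Arguments aug : simpl never.

(** * The homology of an unreduced suspension *)

(** [U] is the quotient of [Y x Delta^1] that collapses each end to a point.
    The interval runs from a vertex A to a vertex B, and its simplices are
    encoded by their number of vertices A. The quotient map is [glue], and [dec]
    is the section of it that puts the base point at the ends. *)
Section UnreducedSuspension.
Local Open Scope ring_scope.
Variables (Y : nat -> Type) (d : forall m, nat -> Y m.+1 -> Y m)
  (s : forall m, nat -> Y m -> Y m.+1).
Arguments d {m} _ _.
Arguments s {m} _ _.
Hypothesis dd : forall m i j (y : Y m.+2), (i < j)%N ->
  d i (d j y) = d j.-1 (d i y).
Hypothesis ds_id : forall m i j (y : Y m), (i == j) || (i == j.+1) ->
  d i (s j y) = y.
Hypothesis ds_lt : forall m i j (y : Y m.+1), (i < j <= m.+1)%N ->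
  d i (s j y) = s j.-1 (d i y).
Hypothesis ds_gt : forall m i j (y : Y m.+1), (j.+1 < i <= m.+2)%N ->
  d i (s j y) = s j (d i.-1 y).

Variable y00 : Y 0.

Fixpoint basept m : Y m := if m is m'.+1 then s 0 (basept m') else y00.
Local Notation y0 := (basept _).

Lemma d_basept m i : (i <= m.+1)%N -> d i (basept m.+1) = basept m.
Proof.
elim: m i => [|m IH] i im; first by apply: ds_id; case: i im => [|[|]].
case: i im => [|[|i]] im; [exact: ds_id|exact: ds_id|].
by rewrite ds_gt // IH.
Qed.

Variables (U : nat -> Type) (dU : forall m, nat -> U m.+1 -> U m).
Arguments dU {m} _ _.
Variables (glue : forall m, nat -> Y m -> U m) (dec : forall m, U m -> nat * Y m).
Arguments glue {m} _ _.
Hypothesis dU_glue : forall m i j (y : Y m.+1),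
  dU j (glue i y) = glue (i - (j < i)) (d j y).
Hypothesis dec_le : forall m (u : U m), ((dec u).1 <= m.+1)%N.
Hypothesis decK : forall m (u : U m), glue (dec u).1 (dec u).2 = u.
Hypothesis dec_glue : forall m i (y : Y m), (i <= m.+1)%N ->
  dec (glue i y) = (i, if (0 < i <= m)%N then y else y0).

Local Notation dY := (fdiff (@d)).
Local Notation dC := (fdiff (@dU)).
Local Notation "[ 'g' x ]" := (free_gen x) (format "[ 'g'  x ]").

Lemma glue0 m (y : Y m) : glue 0 y = glue 0 y0.
Proof. by rewrite -[LHS]decK dec_glue. Qed.

Lemma glue_top m (y : Y m) : glue m.+1 y = glue m.+1 y0.
Proof. by rewrite -[LHS]decK dec_glue //= ltnn. Qed.

(** The homotopy that pushes the interval to B, summed over the prism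
    decomposition of a simplex times an interval. The minimum turns the vertices
    A from the position [j.+1] on into B. *)
Definition prism m i (y : Y m) : free_ab (U m.+1) :=
  \sum_(j < m.+1) [g glue (minn i j.+1) (s j y)] *~ (-1) ^+ j.

Lemma prism_diff m i (y : Y m.+1) : (i <= m.+2)%N ->
  dC _ (prism i y) +
  \sum_(k < m.+2) prism (i - (k < i)) (d k y) *~ (-1) ^+ k =
  [g glue 0 y0] - [g glue i y].
Proof.
move=> im.
pose F k j := [g dU k (glue (minn i j.+1) (s j y))].
pose G k j := [g glue (minn (i - (k < i)) j.+1) (s j (d k y))].
have -> : dC _ (prism i y) =
    \sum_(k < m.+3) (\sum_(j < m.+2) F k j *~ (-1) ^+ j) *~ (-1) ^+ k.
  rewrite raddf_sum (eq_bigr (fun j : 'I_m.+2 =>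
    \sum_(k < m.+3) F k j *~ (-1) ^+ j *~ (-1) ^+ k)).
    by rewrite exchange_big; apply: eq_bigr => k _; rewrite mulrz_suml.
  move=> j _; rewrite raddfMz fdiff_gen mulrz_suml; apply: eq_bigr => k _.
  by rewrite /F -!mulrzA mulrC.
rewrite -[X in _ + X]/(\sum_(k < m.+2)
  (\sum_(j < m.+1) G k j *~ (-1) ^+ j) *~ (-1) ^+ k).
rewrite simplicial_homotopy_sum.
- rewrite /F !dU_glue !ds_id ?eqxx ?orbT //; congr ([g _] - [g _]).
    by rewrite (_ : (_ - _)%N = 0%N) ?glue0 //; lia.
  by congr (glue _ _); lia.
- by move=> k j kj; rewrite /F /G dU_glue ds_lt //; congr [g glue _ _]; lia.
- by move=> k j kj; rewrite /F /G dU_glue ds_gt //; congr [g glue _ _]; lia.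
- by move=> j jm; rewrite /F !dU_glue !ds_id ?eqxx ?orbT //; congr [g glue _ _]; lia.
Qed.

Lemma prism_diff0 i (y : Y 0) : (i <= 1)%N ->
  dC _ (prism i y) = [g glue 0 y0] - [g glue i y].
Proof.
move=> i1; rewrite /prism big_ord1 mulr1z fdiff_gen !big_ord_recl big_ord0 addr0.
rewrite mulr1z mulrz_signS mulr1z !dU_glue !ds_id //.
by case: i i1 => [|[|]] // _; rewrite -(glue0 y).
Qed.

Lemma prism0 m (y : Y m) : prism 0 y = prism 0 y0.
Proof. by apply: eq_bigr => j _; rewrite min0n glue0 [in RHS]glue0. Qed.

(** The shuffle product with the fundamental simplex of the interval. *)
Definition shuffle m : {additive free_ab (Y m) -> free_ab (U m.+1)} :=
  free_lift (prism m.+1).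

(** The contraction to B of [Y x Delta^1] with its end B collapsed, transported
    along [dec]. It does not respect the collapse of the end A; the defect is
    measured by [desusp] in [cone_diff]. *)
Definition cone m : {additive free_ab (U m) -> free_ab (U m.+1)} :=
  free_lift (fun u => prism (dec u).1 (dec u).2).

(** A one-sided inverse to [shuffle]: the face that forgets the last vertex
    survives only on the simplices with a single vertex B. Subtracting the base
    point places the result in the kernel of the augmentation. *)
Definition desusp m : {additive free_ab (U m.+1) -> free_ab (Y m)} :=
  free_lift (fun u =>
    if (dec u).1 == m.+1 then [g d m.+1 (dec u).2] - [g y0] else 0).

Lemma shuffle_gen m (y : Y m) : shuffle m [g y] = prism m.+1 y.
Proof. exact: presented_liftE. Qed.

Lemma cone_gen m i (y : Y m) : (i <= m.+1)%N ->
  cone m [g glue i y] = prism i (if i == m.+1 then y0 else y).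
Proof.
move=> im; rewrite [LHS]presented_liftE dec_glue //=.
case: i im => [|i] im; first by rewrite prism0 [RHS]prism0.
congr (prism _ _); case: eqP => [[->]|im1]; first by rewrite /= ltnn.
by rewrite /= ifT //; lia.
Qed.

Lemma desusp_gen m i (y : Y m.+1) : (i <= m.+2)%N ->
  desusp m [g glue i y] = if i == m.+1 then [g d m.+1 y] - [g y0] else 0.
Proof.
move=> im; rewrite [LHS]presented_liftE dec_glue //=.
by case: eqP => // ->; rewrite ltnSn.
Qed.

(** Generators are normalized so that the collapsed coordinate at the end A is
    the base point, since [cone] sees that coordinate through [dec]. *)
Lemma U_ext m (A : zmodType) (f g : {additive free_ab (U m) -> A}) :
  (forall i (y : Y m), (i <= m.+1)%N -> (i == m.+1 -> y = y0) ->
     f [g glue i y] = g [g glue i y]) -> f =1 g.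
Proof.
move=> fg; apply: free_ext => u; rewrite -(decK u).
have := dec_le u; move: (dec u) => [i y] /= im.
have [->|im1] := eqVneq i m.+1; first by rewrite glue_top; apply: fg.
by apply: fg => //; rewrite (negbTE im1).
Qed.

Arguments shuffle : simpl never.
Arguments cone : simpl never.
Arguments desusp : simpl never.

Definition const_map m (A : zmodType) (Z : nat -> Type) (a : A) :
  {additive free_ab (Z m) -> A} := acomp (int_scale a) (aug Z m).

Lemma const_mapE m A Z a x : @const_map m A Z a x = a *~ aug Z m x.
Proof. by []. Qed.

(** [shuffle] anticommutes with the differential exactly on the kernel of the
    augmentation: the two ends of the interval contribute the cone points B
    and A. *)
Lemma shuffle_diff m x :
  dC _ (shuffle m.+1 x) + shuffle m (dY _ x) =
  ([g glue 0 y0] - [g glue m.+2 y0]) *~ aug Y m.+1 x.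
Proof.
pose f := aadd (acomp (dC _) (shuffle m.+1)) (acomp (shuffle m) (dY m)).
apply: (free_ext (f := f) (g := const_map m.+1 _ _)) => y.
rewrite const_mapE aug_gen mulr1z -(glue_top y) -prism_diff //.
rewrite [LHS]aaddE !acompE; congr (_ + _); first by rewrite shuffle_gen.
rewrite [X in shuffle _ X]fdiff_gen raddf_sum; apply: eq_bigr => k _.
by rewrite raddfMz shuffle_gen; congr (prism _ _ *~ _); rewrite ltn_ord subn1.
Qed.

Lemma shuffle_diff0 x :
  dC _ (shuffle 0 x) = ([g glue 0 y0] - [g glue 1 y0]) *~ aug Y 0 x.
Proof.
pose f := acomp (dC _) (shuffle 0).
apply: (free_ext (f := f) (g := const_map 0 _ _)) => y.
rewrite const_mapE aug_gen mulr1z -(glue_top y) -prism_diff0 //.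
by rewrite acompE shuffle_gen.
Qed.

Lemma desusp_shuffle m x :
  desusp m (shuffle m x) = (x - [g y0] *~ aug Y m x) *~ (-1) ^+ m.
Proof.
pose f := acomp (desusp m) (shuffle m).
pose g := acomp (zscale _ ((-1) ^+ m)) (aadd (aid _) (const_map m Y (- [g y0]))).
suff -> : desusp m (shuffle m x) = g x by rewrite acompE aaddE const_mapE mulNrz.
apply: (free_ext (f := f) (g := g)) => y.
rewrite [RHS]acompE aaddE const_mapE aug_gen mulr1z [LHS]acompE shuffle_gen.
rewrite [LHS]raddf_sum.
rewrite (eq_bigr (fun j : 'I_m.+1 =>
  (if j == m :> nat then [g y] - [g y0] else 0) *~ (-1) ^+ j)); last first.
  move=> j _; have jm := ltn_ord j.
  rewrite [LHS]raddfMz desusp_gen; last by lia.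
  have [->|jm'] := eqVneq (j : nat) m.
    by rewrite minnn eqxx ds_id // eqxx orbT.
  by rewrite ifF //; lia.
rewrite big_ord_recr /= eqxx big1 ?add0r // => j _.
by rewrite ltn_eqF ?mul0rz.
Qed.

(** Only simplices with one or two vertices B contribute. With two of them the
    last two faces cancel. *)
Lemma desusp_diff m x : desusp m (dC _ x) = dY _ (desusp m.+1 x).
Proof.
pose f := acomp (desusp m) (dC m.+1).
pose g := acomp (dY m) (desusp m.+1).
apply: (U_ext (f := f) (g := g)) => i y im _; rewrite !acompE.
have -> : desusp m (dC m.+1 [g glue i y]) =
    \sum_(k < m.+3) (if (i - (k < i))%N == m.+1
       then [g d m.+1 (d k y)] - [g y0] else 0) *~ (-1) ^+ k.
  rewrite [X in desusp _ X]fdiff_gen raddf_sum; apply: eq_bigr => k _.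
  rewrite raddfMz dU_glue desusp_gen //.
  by have := ltn_ord k; lia.
rewrite desusp_gen //.
have [->|im2] := eqVneq i m.+2.
  rewrite raddfB fdiff_gen fdiff_const; last exact: d_basept.
  rewrite big_ord_recr /= ltnn subn0 gtn_eqF // mul0rz addr0.
  rewrite -[odd m]negbK -[~~ ~~ _]/(odd m.+2) -sum_const_sign -sumrB.
  apply: eq_bigr => k _.
  by rewrite ltn_ord subn1 eqxx mulrzBl (dd (i := k)) ?ltn_ord.
rewrite raddf0; have [->|im1] := eqVneq i m.+1.
  have b1 : (m.+2 < m.+1)%N = false by lia.
  rewrite big_ord_recr big_ord_recr /= ltnn b1 subn0 eqxx.
  rewrite big1 ?add0r => [|k _]; last first.
    by rewrite ifF ?mul0rz //; have := ltn_ord k; lia.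
  by rewrite (dd (j := m.+2)) // !mulrz_signS opprK addNr.
rewrite big1 // => k _; rewrite ifF ?mul0rz //.
by have := ltn_ord k; lia.
Qed.

(** By [prism_diff] the homotopy on [Y x Delta^1] joins the identity to the
    constant map at B. The section [dec] fails to be simplicial where a face
    lands in one of the ends. At the end B this is invisible to [prism]; at the
    end A, which only the last face can reach, the error is a shuffle. *)
Lemma cone_diff m x :
  dC _ (cone m.+1 x) + cone m (dC _ x) =
  [g glue 0 y0] *~ aug U m.+1 x - x + shuffle m (desusp m x) *~ (-1) ^+ m.
Proof.
pose f := aadd (acomp (dC _) (cone m.+1)) (acomp (cone m) (dC _)).
pose g := aadd (aadd (const_map m.+1 U [g glue 0 y0]) (zscale _ (-1)))
  (acomp (zscale _ ((-1) ^+ m)) (acomp (shuffle m) (desusp m))).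
suff fg : f =1 g by exact: fg x.
apply: U_ext => i y im y_top; rewrite [RHS]aaddE [X in _ = X + _]aaddE.
rewrite const_mapE aug_gen mulr1z -[X in _ = _ + X + _]/(- [g glue i y]).
rewrite -[X in _ = _ + X]/(shuffle m (desusp m [g glue i y]) *~ (-1) ^+ m).
rewrite -prism_diff // -addrA desusp_gen // [LHS]aaddE.
rewrite -[X in X + _ = _]/(dC _ (cone _ [g glue i y])) cone_gen //.
rewrite (_ : (if _ then _ else _) = y); last by case: ifP => // /y_top.
congr (_ + _); rewrite [LHS]acompE fdiff_gen raddf_sum.
have [i_m1|i_m1] := eqVneq i m.+1; last first.
  rewrite raddf0 mul0rz addr0; apply: eq_bigr => k _.
  have km := ltn_ord k; rewrite [LHS]raddfMz dU_glue cone_gen; last by lia.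
  case: eqP => // i_m2; rewrite y_top; last by apply/eqP; lia.
  by rewrite d_basept // -ltnS.
rewrite {}i_m1 raddfB !shuffle_gen big_ord_recr [in RHS]big_ord_recr -addrA.
congr (_ + _).
  apply: eq_bigr => k _; have km := ltn_ord k.
  rewrite [LHS]raddfMz dU_glue cone_gen /=; last by lia.
  by rewrite ifF //; lia.
rewrite [LHS]raddfMz dU_glue cone_gen /= ltnn subn0 // eqxx.
rewrite !mulrz_signS -mulNrz -[X in _ = X + _]mulNrz -mulrzDl.
by rewrite addrA addNr add0r.
Qed.

Lemma cone_diff0 x : dC _ (cone 0 x) = [g glue 0 y0] *~ aug U 0 x - x.
Proof.
pose f := acomp (dC _) (cone 0).
pose g := aadd (const_map 0 U [g glue 0 y0]) (zscale _ (-1)).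
suff fg : f =1 g by exact: fg x.
apply: U_ext => i y im y_top; rewrite [RHS]aaddE const_mapE aug_gen mulr1z.
rewrite -[X in _ = _ + X]/(- [g glue i y]) -prism_diff0 // [LHS]acompE cone_gen //.
by rewrite (_ : (if _ then _ else _) = y) //; case: ifP => // /y_top.
Qed.

Local Notation HU k := (homology (fface (@dU)) k).
Local Notation HY k := (homology (fface (@d)) k).
Local Notation cycleU k := (@is_cycle _ (fface (@dU)) k).
Local Notation cycleY k := (@is_cycle _ (fface (@d)) k).

Lemma d_vertexB m i : (i <= m.+1)%N ->
  dU i (glue 0 (basept m.+1)) = glue 0 (basept m).
Proof. by move=> im; rewrite dU_glue d_basept. Qed.

Lemma d_vertexA m i : (i <= m.+1)%N ->
  dU i (glue m.+2 (basept m.+1)) = glue m.+1 (basept m).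
Proof. by move=> im; rewrite dU_glue d_basept // ltnS im subn1. Qed.

Lemma cycle_aug (Z : nat -> Type) (dZ : forall m, nat -> Z m.+1 -> Z m) m c :
  is_cycle (fface dZ) c -> aug Z m.+1 c * (odd m)%:R = 0.
Proof. by move=> /eqP c0; rewrite -(aug_fdiff dZ) [fdiff _ _ _]c0 raddf0. Qed.

Lemma suspension_H0 : zmod_iso (HU 0) int.
Proof.
have gD : {morph (fun c : cycle (fface (@dU)) 0 => aug U 0 (val c)) : x y / x + y}.
  by move=> x y; apply: (raddfD (aug U 0) (val x)).
have g_bnd c y : val c = diff (fface (@dU)) y -> additive_of gD c = 0.
  move=> ec; rewrite -[LHS]/(aug U 0 (val c)) ec -[diff _ _]/(dC _ y).
  by rewrite aug_fdiff mulr0.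
apply: (zmod_iso_of (f := hlift g_bnd)).
  move=> h; have [c ->] := hclass_surj h; rewrite hliftE => c0.
  apply/hclass_eq0; exists (- cone 0 (val c)).
  rewrite -[RHS]/(dC _ _) raddfN cone_diff0.
  by rewrite -[aug U 0 _]/(additive_of gD c) c0 mulr0z sub0r opprK.
move=> n; exists (hclass (@Cycle _ (fface (@dU)) 0 ([g glue 0 y0] *~ n) isT)).
by rewrite hliftE -[LHS]/(aug U 0 _) raddfMz aug_gen intz.
Qed.

Lemma desusp_cycle m c : cycleU m.+1 c -> cycleY m (desusp m c).
Proof.
case: m c => [//|m] c /eqP c0; apply/eqP.
by rewrite -[LHS]/(dY _ _) -desusp_diff [dC _ _]c0 raddf0.
Qed.

Lemma desusp_bnd m w :
  exists z, desusp m (diff (fface (@dU)) w) = diff (fface (@d)) z.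
Proof. by exists (desusp m.+1 w); apply: desusp_diff. Qed.

Lemma aug_desusp m x : aug Y m (desusp m x) = 0.
Proof.
pose f := acomp (aug Y m) (desusp m).
pose g := const_map m.+1 U (0 : int).
suff fg : f =1 g by rewrite -[LHS]/(f x) fg const_mapE mul0rz.
apply: U_ext => i y im _; rewrite const_mapE mul0rz acompE desusp_gen //.
by case: eqP => _; rewrite ?raddf0 // raddfB !aug_gen subrr.
Qed.

(** By [cone_diff] a cycle differs, up to boundaries and a sign, from the shuffle
    of its desuspension by a multiple of the cone point B, which is a boundary
    in this degree. If the desuspension is the boundary of [z], then its shuffle
    is a boundary as well: up to sign that of the shuffle of [z], corrected at
    both cone points. *)
Lemma desusp_inj m c z : cycleU m.+1 c ->
  desusp m c = diff (fface (@d)) z -> exists w, c = diff (fface (@dU)) w.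
Proof.
move=> c_cyc ez.
have [w0 ew0] : exists w, [g glue 0 (basept m.+1)] *~ aug U m.+1 c = dC _ w.
  apply: (const_bounds (p := fun m => glue 0 (basept m))).
    exact: d_vertexB.
  exact: cycle_aug c_cyc.
have z_aug : aug Y m.+1 z * (odd m)%:R = 0.
  by rewrite -(aug_fdiff (@d)) -[fdiff _ _ _]ez aug_desusp.
have [w1 ew1] : exists w, [g glue 0 (basept m.+1)] *~ aug Y m.+1 z = dC _ w.
  apply: (const_bounds (p := fun m => glue 0 (basept m))) z_aug.
  exact: d_vertexB.
have [w2 ew2] : exists w, [g glue m.+2 (basept m.+1)] *~ aug Y m.+1 z = dC _ w.
  apply: (const_bounds (p := fun m => glue m.+1 (basept m))) z_aug.
  exact: d_vertexA.
have ez' : dY m z = desusp m c by [].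
have := shuffle_diff z; rewrite ez' mulrzBl ew1 ew2.
move=> /eqP; rewrite addrC eq_sym -subr_eq => /eqP esh.
have := cone_diff c; move/eqP: (c_cyc) => c0.
rewrite [X in cone m X]c0 raddf0 addr0 ew0 -esh => ec.
exists (w0 + (w1 - w2 - shuffle m.+1 z) *~ (-1) ^+ m - cone m.+1 c).
rewrite -[RHS]/(dC _ _) raddfB raddfD raddfMz !raddfB ec.
by rewrite [X in _ - X]addrAC opprB addrCA subrr addr0.
Qed.

Lemma reduced_cycle m x : cycleY m x -> cycleY m (x - [g y0] *~ aug Y m x).
Proof.
case: m x => [//|m] x x_cyc; apply/eqP; rewrite -[LHS]/(dY m _).
rewrite raddfB raddfMz fdiff_const; last exact: d_basept.
move/eqP: (x_cyc) => x0; rewrite [dY _ x]x0 sub0r.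
by rewrite -mulrzA mulrC (cycle_aug x_cyc) mulr0z oppr0.
Qed.

Lemma desusp_surj m x : cycleY m x ->
  exists2 c, cycleU m.+1 c & desusp m c = x - [g y0] *~ aug Y m x.
Proof.
move=> x_cyc; pose px := x - [g y0] *~ aug Y m x.
have px_aug : aug Y m px = 0 by rewrite raddfB raddfMz aug_gen intz subrr.
have sh_cyc : dC _ (shuffle m px) = 0.
  have px_cyc : cycleY m px by apply: reduced_cycle.
  case: m x x_cyc px px_aug px_cyc => [|m] x x_cyc px px_aug px_cyc.
    by rewrite shuffle_diff0 px_aug mulr0z.
  have := shuffle_diff px; rewrite px_aug mulr0z.
  by move/eqP: px_cyc => px0; rewrite [dY _ px]px0 raddf0 addr0.
exists (shuffle m px *~ (-1) ^+ m).
  by apply/eqP; rewrite -[LHS]/(dC _ _) raddfMz sh_cyc mul0rz.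
by rewrite raddfMz desusp_shuffle px_aug mulr0z subr0 mulrz_signK.
Qed.

Lemma suspension_Hk k : (2 <= k)%N -> zmod_iso (HU k) (HY k.-1).
Proof.
case: k => [|[|m]] // _.
apply: (zmod_iso_of (f := homology_map (@desusp_cycle m.+1) (@desusp_bnd m.+1))).
  exact: homology_map_inj (@desusp_inj m.+1).
move=> h; have [x ->] := hclass_surj h.
have [c c_cyc ec] := desusp_surj (valP x).
exists (hclass (Cycle c_cyc)); rewrite homology_mapE.
apply/subr0_eq; rewrite -raddfB; apply/hclass_eq0.
have [w ew] := const_bounds d_basept (cycle_aug (valP x)).
exists (- w); rewrite -[RHS]/(dY _ _) raddfN -ew.
by rewrite -[LHS]/(desusp m.+1 c - val x) ec addrAC subrr sub0r.
Qed.

(** In degree [0] desuspension only reaches the kernel of the augmentation; the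
    base point supplies the missing copy of the integers. *)
Lemma suspension_H1 : zmod_iso (HU 1 * int)%type (HY 0).
Proof.
pose f := homology_map (@desusp_cycle 0) (@desusp_bnd 0).
pose b (n : int) : cycle (fface (@d)) 0 :=
  @Cycle _ (fface (@d)) 0 ([g y0] *~ n) isT.
have bD n n' : b (n + n') = b n + b n' by apply: val_inj; rewrite /= mulrzDr.
have phiD : {morph (fun p : HU 1 * int => f p.1 + hclass (b p.2)) : p q / p + q}.
  by move=> p q; rewrite raddfD bD raddfD addrACA.
apply: (zmod_iso_of (f := additive_of phiD)).
  move=> [h n]; have [c ->] := hclass_surj h.
  rewrite -[LHS]/(f (hclass c) + hclass (b n)) [f _]homology_mapE -raddfD.
  move=> /hclass_eq0[z]; rewrite -[LHS]/(desusp 0 (val c) + [g y0] *~ n) => ez.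
  have n0 : n = 0.
    have := congr1 (aug Y 0) ez; rewrite -[diff _ _]/(dY _ z) aug_fdiff mulr0.
    by rewrite raddfD raddfMz aug_desusp add0r aug_gen intz.
  rewrite n0 mulr0z addr0 in ez *.
  have [w ew] := desusp_inj (valP c) ez.
  by congr (_, _); apply/hclass_eq0; exists w.
move=> h; have [x ->] := hclass_surj h.
have [c c_cyc ec] := desusp_surj (valP x).
exists (hclass (Cycle c_cyc), aug Y 0 (val x)).
rewrite -[LHS]/(f (hclass (Cycle c_cyc)) + hclass (b (aug Y 0 (val x)))).
rewrite [f _]homology_mapE -raddfD; congr hclass; apply: val_inj.
by rewrite -[LHS]/(desusp 0 c + [g y0] *~ aug Y 0 (val x)) ec subrK.
Qed.

End UnreducedSuspension.

(** * Magnitude homology of a suspension *)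

Section NerveSimplices.
Local Open Scope ring_scope.
Variables (n : nat) (X : strict_cat n.+1).

Definition simplices (m : nat) : Type := multinerve n m X.

Definition simplex_face m (i : nat) : simplices m.+1 -> simplices m :=
  fun y => papp (dface (multinerve n) i) y.

Definition simplex_degen m (i : nat) : simplices m -> simplices m.+1 :=
  fun y => papp (ddegen (multinerve n) i) y.

(** Freeness in each degree turns magnitude homology into the homology of the
    multinerve. *)
Lemma MH_simplices k : zmod_iso (MH X k) (homology (fface simplex_face) k).
Proof.
apply: zmod_iso_sym.
pose B := multinerve_basis n.
apply: (homology_transfer
  (g := fun m => free_lift (fun y : simplices m => bgen (B m) y))).
  by move=> m; apply: basis_bij.
move=> m i.
apply: (free_ext (f := acomp (free_lift _) (fface simplex_face i))
  (g := acomp (sface (MB n) i X) (free_lift _))) => y.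
rewrite !acompE [X in _ = sface _ _ _ X]presented_liftE sface_gen.
by rewrite [X in free_lift _ X]presented_liftE [LHS]presented_liftE.
Qed.

Lemma simplex_faceK m i j (y : simplices m.+2) : (i < j)%N ->
  simplex_face i (simplex_face j y) = simplex_face j.-1 (simplex_face i y).
Proof. by move=> ij; exact (dfaceK y ij). Qed.

Lemma simplex_degenK m i j (y : simplices m) : (i == j) || (i == j.+1) ->
  simplex_face i (simplex_degen j y) = y.
Proof. by move=> ij; exact (ddegenK y ij). Qed.

Lemma simplex_degen_lt m i j (y : simplices m.+1) : (i < j <= m.+1)%N ->
  simplex_face i (simplex_degen j y) = simplex_degen j.-1 (simplex_face i y).
Proof. by move=> ij; exact (ddegen_lt y ij). Qed.

Lemma simplex_degen_gt m i j (y : simplices m.+1) : (j.+1 < i <= m.+2)%N ->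
  simplex_face i (simplex_degen j y) = simplex_degen j (simplex_face i.-1 y).
Proof. by move=> ij; exact (ddegen_gt y ij). Qed.

End NerveSimplices.

Lemma multinerve_zero n m : multinerve n m (ecat_zero (nCat n)) -> False.
Proof. by case: n => [|n] [[]]. Qed.

Theorem theorem8p3 (n : nat) (X : strict_cat n.+1)
    (X_nonempty : inhabited (objects X)) :
  [/\ zmod_iso (MH (suspension X) 0) int,
      forall k : nat, 2 <= k ->
        zmod_iso (MH (suspension X) k) (MH X k.-1)
    & zmod_iso (MH (suspension X) 1 * int)%type (MH X 0)].
Proof.
case: X_nonempty => x.
have y00 : simplices X 0 by case: n X x => [|n'] X' x'; exists x'.
pose T m := multinerve n m.
pose y0 := basept (@simplex_degen n X) y00.
pose glue m i (y : simplices X m) : simplices (suspension X) m :=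
  susp_simplex (T := T m) m i y.
pose dec m (u : simplices (suspension X) m) : nat * simplices X m :=
  susp_dec (T := T m) (y0 m) u.
have dU_glue m i j (y : simplices X m.+1) :
    simplex_face j (glue m.+1 i y) = glue m (i - (j < i))%N (simplex_face j y).
  rewrite -[LHS]/(nface j (nervenat (dface (multinerve n) j)
    (susp_simplex (T := T m.+1) m.+1 i y))).
  by rewrite nervenat_susp nface_susp.
have dec_le m u : ((dec m u).1 <= m.+1)%N by apply: susp_dec_le.
have decK m u : glue m (dec m u).1 (dec m u).2 = u.
  exact: (susp_decK (@multinerve_zero n m)).
have dec_glue m i y : (i <= m.+1)%N ->
    dec m (glue m i y) = (i, if (0 < i <= m)%N then y else y0 m).
  exact: susp_decE.
pose faceK := @simplex_faceK n X; pose degenK := @simplex_degenK n X.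
pose degen_lt := @simplex_degen_lt n X; pose degen_gt := @simplex_degen_gt n X.
split.
- apply: zmod_iso_trans (MH_simplices _ _) _.
  exact (suspension_H0 degenK dU_glue dec_le decK dec_glue).
- move=> k k2; apply: zmod_iso_trans (MH_simplices _ _) _.
  apply: zmod_iso_trans _ (zmod_iso_sym (MH_simplices X k.-1)).
  exact (suspension_Hk faceK degenK degen_lt degen_gt
    dU_glue dec_le decK dec_glue k2).
- apply: zmod_iso_trans _ (zmod_iso_sym (MH_simplices X 0)).
  apply: zmod_iso_trans (zmod_iso_prod _ (MH_simplices (suspension X) 1)) _.
  exact (suspension_H1 faceK degenK degen_lt degen_gt
    dU_glue dec_le decK dec_glue).
Qed.
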